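(* For all real $t>0$ and all integers $k\ge1$, $$|\widetilde{R}_{k+1}(t)| \le \frac{\pi^{1/2}\,\Gamma(k-\frac12)\,|B_{2k}|}{8\,k!\,t^{2k-1}}.$$
   Context: $B_{2j}(u)$ is the Bernoulli polynomial and $B_{2j}=B_{2j}(0)$ the Bernoulli number. $\log$ is the principal branch of the logarithm on $\mathbb{C}\setminus(-\infty,0]$. $\ln\Gamma$ denotes the analytic function on $\mathbb{C}\setminus(-\infty,0]$ with $\exp(\ln\Gamma(z))=\Gamma(z)$ that is real and equal to $\log(\Gamma(x))$ for real $x>0$. For integers $j\ge 1$, $\widehat{T}_j(z) = \frac{B_{2j}(\frac12)}{2j(2j-1)z^{2j-1}}$, and for integers $k\ge 1$ and $z\in\mathbb{C}$ with $\Re(z)\ge0$, $z\neq0$, the remainder $\widehat{R}_k(z)$ is defined by $$\ln\Gamma(z+\tfrac12) = z\log z - z + \tfrac12\log(2\pi) + \sum_{j=1}^{k-1}\widehat{T}_j(z) + \widehat{R}_k(z).$$ For real $t>0$, $\widetilde{R}_{k}(t) := \Im\left(\tfrac12\widehat{R}_{k}(it)\right)$. It is the remainder in the expansion $$\vartheta(t) = \frac{t}{2} \log\left(\frac{t}{2\pi e}\right) - \frac{\pi}{8} + \frac{\arctan(e^{-\pi t})}{2} + \sum_{j=1}^{k-1}\widetilde{T}_j(t) + \widetilde{R}_{k}(t),\qquad \widetilde{T}_j(t) := \frac{|B_{2j}(\frac12)|}{4j(2j-1)t^{2j-1}},$$ of the Riemann-Siegel theta function $\vartheta(t) = \arg\Gamma\left(\frac{it}{2}+\frac14\right)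 - \frac{t}{2}\log\pi$ (argument chosen so that $\vartheta$ is continuous on $\mathbb{R}$ with $\vartheta(0)=0$). *)

(* Defs.v *)
From Stdlib Require Import Reals Lra Lia Arith.
From Coquelicot Require Import Coquelicot.

Open Scope R_scope.

Definition Cexp (z : C) : C :=
  (exp (Re z) * cos (Im z), exp (Re z) * sin (Im z)).

(** The principal argument, with values in (-PI, PI]. *)
Definition Carg (z : C) : R :=
  if Rle_dec 0 (Im z) then acos (Re z / Cmod z) else - acos (Re z / Cmod z).

Definition Clog (z : C) : C := (ln (Cmod z), Carg z).

Definition slit_plane (z : C) : Prop := ~ (Im z = 0 /\ Re z <= 0).

Fixpoint rising (z : C) (n : nat) : C :=
  match n with
  | O => RtoC 1
  | S m => (rising z m * (z + RtoC (INR m)))%C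
  end.

(** Gauss's definition of the Gamma function on all of C minus its poles:
    Gamma z = lim n! n^z / (z (z + 1) ... (z + n)).
    The limit is taken on the real and imaginary parts. *)
Definition Gamma_seq (z : C) (n : nat) : C :=
  (RtoC (INR (fact n)) * Cexp (z * RtoC (ln (INR n))) / rising z (S n))%C.

Definition Gamma (z : C) : C :=
  (real (Lim_seq (fun n => Re (Gamma_seq z n))),
   real (Lim_seq (fun n => Im (Gamma_seq z n)))).

(** Gamma on the real axis, where its values are real. *)
Definition Gamma_R (x : R) : R := Re (Gamma (RtoC x)).

(** [L] is the function ln Gamma: holomorphic (complex differentiable at each
    point) on the open set [slit_plane], a logarithm of Gamma there, and equal
    to the real logarithm of Gamma on the positive reals.  These conditions
    determine the values of [L] on [slit_plane]. *)
Definition is_lnGamma (L : C -> C) : Prop :=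
  (forall z : C, slit_plane z ->
     @ex_derive C_AbsRing C_NormedModule L z) /\
  (forall z : C, slit_plane z -> Cexp (L z) = Gamma z) /\
  (forall x : R, 0 < x -> L (RtoC x) = RtoC (ln (Gamma_R x))).

(** [bernoulli_upto n j] is B_j for j <= n; the recursion is the classical
    (n + 1) B_n = - sum_(j < n) binom(n + 1, j) B_j, so that B_1 = - 1/2. *)
Fixpoint bernoulli_upto (n : nat) : nat -> R :=
  match n with
  | O => fun _ => 1
  | S m => fun j =>
      if (j <=? m)%nat then bernoulli_upto m j
      else - sum_f_R0 (fun i => Binomial.C (S n) i * bernoulli_upto m i) m
             / INR (S n)
  end.

Definition bernoulli (n : nat) : R := bernoulli_upto n n.

Definition bernoulli_poly (n : nat) (u : R) : R :=
  sum_f_R0 (fun j => Binomial.C n j * bernoulli j * u ^ (n - j)) n.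

Lemma bernoulli_upto_eq (n j : nat) :
  (j <= n)%nat -> bernoulli_upto n j = bernoulli j.
Proof.
induction n as [|n IH]; intros Hj.
- now replace j with O by lia.
- destruct (Nat.eq_dec j (S n)) as [->|Hne]; [reflexivity|].
  simpl. rewrite (proj2 (Nat.leb_le j n)) by lia. apply IH; lia.
Qed.

Lemma bernoulli_0 : bernoulli 0 = 1.
Proof. reflexivity. Qed.

Lemma bernoulli_rec (n : nat) : (1 <= n)%nat ->
  sum_f_R0 (fun j => Binomial.C (S n) j * bernoulli j) n = 0.
Proof.
destruct n as [|m]; [lia|intros _].
rewrite tech5.
assert (E : bernoulli (S m) =
  - sum_f_R0 (fun i => Binomial.C (S (S m)) i * bernoulli i) m
    / INR (S (S m))).
{ unfold bernoulli at 1.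
  change (bernoulli_upto (S m) (S m)) with
    (if (S m <=? m)%nat then bernoulli_upto m (S m)
     else - sum_f_R0 (fun i => Binomial.C (S (S m)) i * bernoulli_upto m i) m
            / INR (S (S m))).
  rewrite (proj2 (Nat.leb_gt (S m) m)) by lia.
  do 2 f_equal. apply sum_eq. intros i Hi.
  now rewrite bernoulli_upto_eq. }
rewrite E.
assert (HC : Binomial.C (S (S m)) (S m) = INR (S (S m))).
{ unfold Binomial.C.
  replace (S (S m) - S m)%nat with 1%nat by lia.
  rewrite (fact_simpl (S m)), mult_INR. simpl (fact 1). simpl (INR 1).
  field. apply INR_fact_neq_0. }
rewrite HC. field. apply not_0_INR; lia.
Qed.

Lemma bernoulli_poly_0 (n : nat) : bernoulli_poly n 0 = bernoulli n.
Proof.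
unfold bernoulli_poly. destruct n as [|n].
- simpl. unfold Binomial.C. simpl. rewrite bernoulli_0. field.
- rewrite tech5, (sum_eq _ (fun _ => 0)).
  + rewrite sum_cte, Nat.sub_diag, pascal_step1 by lia.
    rewrite Nat.sub_diag, C_n_0. simpl. ring.
  + intros i Hi. rewrite pow_i by lia. ring.
Qed.

Definition T_hat (j : nat) (z : C) : C :=
  (RtoC (bernoulli_poly (2 * j) (1 / 2)) /
   (RtoC (INR (2 * j) * INR (2 * j - 1)) * z ^ (2 * j - 1)))%C.

(** Meant for 1 <= k, 0 <= Re z and z <> 0; the sum is empty for k = 1. *)
Definition R_hat (lnGamma : C -> C) (k : nat) (z : C) : C :=
  (lnGamma (z + RtoC (1 / 2)) -
   (z * Clog z - z + RtoC (1 / 2 * ln (2 * PI)) +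
    sum_n_m (fun j => T_hat j z) 1 (k - 1)))%C.

Definition R_tilde (lnGamma : C -> C) (k : nat) (t : R) : R :=
  Im (RtoC (1 / 2) * R_hat lnGamma k (Ci * RtoC t))%C.

(* Main.v *)
Require Import Defs.
From Stdlib Require Import Reals Arith Factorial.
From Stdlib Require Import Lra Lia.
From Coquelicot Require Import Coquelicot.
Open Scope R_scope.

(** Gauss's product turns the imaginary part of the logarithm of Gamma at
    1/2 + i t into the limit th of

      [theta_seq t n] = t ln n - sum over m <= n of arg (m + 1/2 + i t).

    The sum is compared with an integral by the Euler-Maclaurin formula with
    nodes at the midpoints of the unit intervals.  The integral and the terms
    at infinity cancel against t ln n, the terms at 0 are t ln t - t and the
    imaginary parts of the T_hat j (i t), and what remains is at most

      |B_2k| / (2k) * integral over u >= 0 of du / (u^2 + t^2)^k,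

    because |B_2k(v)| <= |B_2k| on [0, 1] and because the 2k-th derivative of
    u |-> log (u + i t) has modulus (2k-1)! / (u^2 + t^2)^k.  The integral is
    sqrt PI * Gamma (k - 1/2) / (2 (k-1)! t^(2k-1)), and R_tilde is half the
    imaginary part of the remainder, which gives the stated constant.

    No integral is needed for the Euler-Maclaurin part: by telescoping, all
    error terms are increments over an interval of a function whose
    derivative is dominated by the derivative of an explicit majorant
    ([increment_bound], [em_step], [em_sum]).

    - The bound on B_2k ([even_bernoulli_poly_bound]) comes from the
      alternating signs of the odd Bernoulli polynomials on [0, 1/2]: from
      degree 3 on, each is convex or concave there according to the sign of
      the preceding one, and vanishes at both ends.
    - The value of the integral ([kernel_integral_limit_Gamma]) comes from a
      recursion in k, the functional equation of Gamma and Wallis's formula.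
    - Gauss's product alone gives the imaginary part of ln Gamma only modulo
      2 PI.  The case of the Euler-Maclaurin formula with no correction term
      keeps th within PI / 4 of t ln t - t for every t > 0.  Hence
      Im ln Gamma (1/2 + i t) - (t ln t - t) never takes the values PI and
      - PI; it is continuous and tends to 0 at t = 0, so it stays between
      them, and the multiple of 2 PI is 0 ([im_lnGamma_critical_line]). *)

(** * Calculus on an interval *)

Lemma MVT_closed (f df : R -> R) (a b : R) :
  a <= b -> (forall x, a <= x <= b -> is_derive f x (df x)) ->
  exists c, a <= c <= b /\ f b - f a = df c * (b - a).
Proof.
intros Hab Hd.
destruct (MVT_gen f a b df) as [c [Hc E]].
- intros x Hx. rewrite Rmin_left, Rmax_right in Hx by lra. apply Hd; lra.
- intros x Hx. rewrite Rmin_left, Rmax_right in Hx by lra.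
  apply derivable_continuous_pt, ex_derive_Reals_0.
  exists (df x). now apply Hd.
- rewrite Rmin_left, Rmax_right in Hc by lra. now exists c.
Qed.

(** A mean value inequality with a varying bound: [w - f] and [w + f] are both
    nondecreasing.  It replaces the estimate of an integral by the integral of
    a majorant. *)
Lemma increment_bound (f df w dw : R -> R) (a b : R) :
  a <= b ->
  (forall x, a <= x <= b -> is_derive f x (df x)) ->
  (forall x, a <= x <= b -> is_derive w x (dw x)) ->
  (forall x, a <= x <= b -> Rabs (df x) <= dw x) ->
  Rabs (f b - f a) <= w b - w a.
Proof.
intros Hab Hf Hw Hle.
assert (H1 : exists c, a <= c <= b /\
    (w b - f b) - (w a - f a) = (dw c - df c) * (b - a)).
{ apply (MVT_closed (fun x => w x - f x) (fun x => dw x - df x)); [easy|].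
  intros x Hx. apply @is_derive_minus; auto. }
assert (H2 : exists c, a <= c <= b /\
    (w b + f b) - (w a + f a) = (dw c + df c) * (b - a)).
{ apply (MVT_closed (fun x => w x + f x) (fun x => dw x + df x)); [easy|].
  intros x Hx. apply @is_derive_plus; auto. }
destruct H1 as [c1 [Hc1 E1]]. destruct H2 as [c2 [Hc2 E2]].
assert (L1 := Hle c1 Hc1). assert (L2 := Hle c2 Hc2).
apply Rabs_le_between in L1. apply Rabs_le_between in L2.
assert (0 <= (dw c1 - df c1) * (b - a)) by (apply Rmult_le_pos; lra).
assert (0 <= (dw c2 + df c2) * (b - a)) by (apply Rmult_le_pos; lra).
apply Rabs_le; lra.
Qed.

Lemma is_derive_sum_f_R0 (f : nat -> R -> R) (d : nat -> R) (n : nat) (x : R) :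
  (forall k, (k <= n)%nat -> is_derive (f k) x (d k)) ->
  is_derive (fun y => sum_f_R0 (fun k => f k y) n) x (sum_f_R0 d n).
Proof.
intros H. rewrite <- sum_n_Reals.
apply (is_derive_ext (fun y => sum_n (fun k => f k y) n)).
- intros y. apply sum_n_Reals.
- now apply (is_derive_sum_n (V := R_NormedModule)).
Qed.

Lemma is_derive_Rminus (f g : R -> R) (x df dg d : R) :
  is_derive f x df -> is_derive g x dg -> df - dg = d ->
  is_derive (fun y => f y - g y) x d.
Proof. intros Hf Hg <-. now apply @is_derive_minus. Qed.

(** * Bernoulli polynomials *)

Lemma is_derive_bernoulli_poly (n : nat) (x : R) :
  is_derive (bernoulli_poly (S n)) x (INR (S n) * bernoulli_poly n x).
Proof.
unfold bernoulli_poly. rewrite scal_sum.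
set (g := fun j y => Binomial.C (S n) j * bernoulli j * y ^ (S n - j)).
change (is_derive (fun u => sum_f_R0 (fun j => g j u) (S n)) x
  (sum_f_R0
     (fun i => Binomial.C n i * bernoulli i * x ^ (n - i) * INR (S n)) n)).
apply (is_derive_ext
  (fun u => plus (sum_f_R0 (fun j => g j u) n) (bernoulli (S n)))).
{ intros u. rewrite tech5. unfold g at 3.
  rewrite Nat.sub_diag. unfold plus; simpl.
  replace (Binomial.C (S n) (S n)) with 1; [ring|].
  unfold Binomial.C. rewrite Nat.sub_diag. simpl (fact 0). simpl (INR 1).
  field. apply INR_fact_neq_0. }
rewrite <- (Rplus_0_r (sum_f_R0 _ n)).
apply @is_derive_plus; [|apply @is_derive_const].
apply is_derive_sum_f_R0. intros j Hj. unfold g.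
replace (S n - j)%nat with (S (n - j)) by lia.
auto_derive; [easy|]. cbn [Nat.pred].
replace (Binomial.C (S n) j)
  with (Binomial.C n j * INR (S n) / INR (S (n - j))).
- change (match (n - j)%nat with 0%nat => 1 | S _ => INR (n - j) + 1 end)
    with (INR (S (n - j))).
  field. apply not_0_INR; lia.
- unfold Binomial.C. replace (S n - j)%nat with (S (n - j)) by lia.
  rewrite !fact_simpl, !mult_INR. field.
  repeat split; try apply INR_fact_neq_0; apply not_0_INR; lia.
Qed.

Lemma bernoulli_poly_1 (n : nat) :
  (2 <= n)%nat -> bernoulli_poly n 1 = bernoulli_poly n 0.
Proof.
intros Hn. rewrite bernoulli_poly_0. unfold bernoulli_poly.
rewrite (sum_eq _ (fun j => Binomial.C n j * bernoulli j)).
2:{ intros i Hi. rewrite pow1. ring. }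
destruct n as [|m]; [lia|]. rewrite tech5, bernoulli_rec by lia.
unfold Binomial.C. rewrite Nat.sub_diag. simpl (fact 0). simpl (INR 1).
field. apply INR_fact_neq_0.
Qed.

Lemma bernoulli_poly_deg0 (x : R) : bernoulli_poly 0 x = 1.
Proof.
unfold bernoulli_poly, Binomial.C. simpl. rewrite bernoulli_0. field.
Qed.

Lemma bernoulli_poly_deg1 (x : R) : bernoulli_poly 1 x = x - 1 / 2.
Proof.
assert (E : bernoulli 1 = - 1 / 2).
{ unfold bernoulli, bernoulli_upto, Binomial.C. simpl. field. }
unfold bernoulli_poly, Binomial.C. simpl.
rewrite bernoulli_0, E. field.
Qed.

(** Uniqueness of Bernoulli polynomials: if [P n] vanishes then [P (S n)] is
    constant, and this constant is the slope of [P (S (S n))] up to a nonzero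
    factor, hence 0 since that function has equal values at [a] and [b]. *)
Lemma appell_eq_0 (P : nat -> R -> R) (c : nat -> R) (a b : R) :
  a < b -> (forall n, c n <> 0) -> (forall x, P 0%nat x = 0) ->
  (forall n x, is_derive (P (S n)) x (c n * P n x)) ->
  (forall n, (2 <= n)%nat -> P n b = P n a) ->
  forall n x, P n x = 0.
Proof.
intros Hab Hc H0 Hd He.
induction n as [|n IH]; [easy|].
assert (K : forall x, P (S n) x = P (S n) a).
{ intros x. apply Rminus_diag_uniq, Rabs_eq_0, Rle_antisym, Rabs_pos.
  rewrite <- (Rminus_diag 0).
  destruct (Rle_dec a x) as [Hx|Hx]; [|rewrite Rabs_minus_sym];
  apply (increment_bound (P (S n)) (fun y => c n * P n y)
         (fun _ => 0) (fun _ => 0)); try lra; intros y _;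
  try apply Hd; try apply @is_derive_const;
  rewrite IH, Rmult_0_r, Rabs_R0; lra. }
destruct (MVT_closed (P (S (S n))) (fun y => c (S n) * P (S n) y) a b)
  as [z [Hz E]]; [lra|intros y _; apply Hd|].
rewrite He, Rminus_diag, K in E by lia.
assert (Z : P (S n) a = 0).
{ symmetry in E. apply Rmult_integral in E. destruct E as [E|E]; [|lra].
  apply Rmult_integral in E. destruct E as [E|E]; [|easy].
  now destruct (Hc (S n)). }
intros x. now rewrite K.
Qed.

(** The difference of the two sides satisfies the hypotheses of
    [appell_eq_0] on [0, 1]. *)
Lemma bernoulli_poly_symm (n : nat) (x : R) :
  bernoulli_poly n (1 - x) = (-1) ^ n * bernoulli_poly n x.
Proof.
apply Rminus_diag_uniq.
apply (appell_eq_0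
  (fun n x => bernoulli_poly n (1 - x) - (-1) ^ n * bernoulli_poly n x)
  (fun n => - INR (S n)) 0 1); clear n x.
- lra.
- intros n. apply Ropp_neq_0_compat, not_0_INR; lia.
- intros x. rewrite !bernoulli_poly_deg0. simpl. ring.
- intros n x.
  evar_last.
  + apply @is_derive_minus.
    * apply (is_derive_comp (bernoulli_poly (S n)) (fun x => 1 - x)).
      -- apply is_derive_bernoulli_poly.
      -- evar_last; [apply @is_derive_minus;
           [apply @is_derive_const|apply @is_derive_id]|reflexivity].
    * apply is_derive_scal. apply is_derive_bernoulli_poly.
  + unfold minus, plus, opp, scal, zero, one; simpl.
    unfold mult; simpl. ring.
- intros n Hn. cbv beta. rewrite Rminus_diag, Rminus_0_r.
  rewrite bernoulli_poly_1 by easy. ring.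
Qed.

(** The difference of the two sides satisfies the hypotheses of
    [appell_eq_0] on [0, 1/2]: at the two end points the values at 0, 1/2 and
    1 that appear are the same because B_n(1) = B_n(0). *)
Lemma bernoulli_poly_duplication (n : nat) (x : R) :
  bernoulli_poly n x + bernoulli_poly n (x + 1 / 2)
  = 2 * (/ 2) ^ n * bernoulli_poly n (2 * x).
Proof.
apply Rminus_diag_uniq.
apply (appell_eq_0
  (fun n x => bernoulli_poly n x + bernoulli_poly n (x + 1 / 2)
     - 2 * (/ 2) ^ n * bernoulli_poly n (2 * x))
  (fun n => INR (S n)) 0 (1 / 2)); clear n x.
- lra.
- intros n. apply not_0_INR; lia.
- intros x. rewrite !bernoulli_poly_deg0. simpl. ring.
- intros n x.
  evar_last.
  + apply @is_derive_minus; [apply @is_derive_plus|].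
    * apply is_derive_bernoulli_poly.
    * apply (is_derive_comp (bernoulli_poly (S n)) (fun x => x + 1 / 2)).
      -- apply is_derive_bernoulli_poly.
      -- evar_last; [apply @is_derive_plus;
           [apply @is_derive_id|apply @is_derive_const]|reflexivity].
    * apply is_derive_scal.
      apply (is_derive_comp (bernoulli_poly (S n)) (fun x => 2 * x)).
      -- apply is_derive_bernoulli_poly.
      -- apply is_derive_scal, @is_derive_id.
  + unfold minus, plus, opp, scal, zero, one; simpl.
    unfold mult; simpl. field.
- intros n Hn. cbv beta.
  replace (1 / 2 + 1 / 2) with 1 by field.
  replace (2 * (1 / 2)) with 1 by field.
  rewrite Rplus_0_l, Rmult_0_r, bernoulli_poly_1 by easy. ring.
Qed.

Lemma bernoulli_poly_half (n : nat) :
  bernoulli_poly n (1 / 2) = (2 * (/ 2) ^ n - 1) * bernoulli_poly n 0.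
Proof.
assert (E := bernoulli_poly_duplication n 0).
rewrite Rplus_0_l, Rmult_0_r in E. lra.
Qed.

Lemma odd_bernoulli_poly_0 (n : nat) :
  (1 <= n)%nat -> bernoulli_poly (2 * n + 1) 0 = 0.
Proof.
intros Hn. assert (E := bernoulli_poly_symm (2 * n + 1) 0).
rewrite Rminus_0_r, bernoulli_poly_1, Nat.add_1_r, pow_1_odd in E by lia.
rewrite Nat.add_1_r. lra.
Qed.

Lemma odd_bernoulli_poly_half (n : nat) :
  bernoulli_poly (2 * n + 1) (1 / 2) = 0.
Proof.
destruct n as [|n].
- change (2 * 0 + 1)%nat with 1%nat. rewrite bernoulli_poly_deg1. ring.
- rewrite bernoulli_poly_half, odd_bernoulli_poly_0 by lia. ring.
Qed.

Lemma convex_nonpos (f f1 f2 : R -> R) (a b : R) :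
  (forall x, a <= x <= b -> is_derive f x (f1 x)) ->
  (forall x, a <= x <= b -> is_derive f1 x (f2 x)) ->
  (forall x, a <= x <= b -> 0 <= f2 x) ->
  f a = 0 -> f b = 0 -> forall x, a <= x <= b -> f x <= 0.
Proof.
intros H1 H2 Hpos Ha Hb x Hx.
destruct (MVT_closed f f1 a x) as [c [Hc Ec]]; [lra|intros; apply H1; lra|].
destruct (MVT_closed f f1 x b) as [d [Hd Ed]]; [lra|intros; apply H1; lra|].
destruct (MVT_closed f1 f2 c d) as [e [He Ee]]; [lra|intros; apply H2; lra|].
assert (0 <= f2 e * (d - c)) by (apply Rmult_le_pos; [apply Hpos|]; lra).
apply Rnot_lt_le. intros Hf.
(* positive at [x] forces a positive slope before [x], a negative one after *)
assert (0 < f1 c).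
{ apply Rnot_le_lt. intros Hle.
  assert (0 <= - f1 c * (x - a)) by (apply Rmult_le_pos; lra). lra. }
assert (0 <= f1 d * (b - x)) by (apply Rmult_le_pos; lra).
lra.
Qed.

(** The second derivative of B_(2n+3) is a positive multiple of B_(2n+1), so
    the sign of the latter makes the former convex or concave on [0, 1/2];
    since B_(2n+3) vanishes at both ends, its sign is the opposite one. *)
Lemma odd_bernoulli_poly_sign (n : nat) (x : R) :
  0 <= x <= 1 / 2 -> 0 <= (-1) ^ (S n) * bernoulli_poly (2 * n + 1) x.
Proof.
revert x. induction n as [|n IH]; intros x Hx.
- change (2 * 0 + 1)%nat with 1%nat. rewrite bernoulli_poly_deg1. simpl. lra.
- replace (2 * S n + 1)%nat with (S (S (2 * n + 1))) by lia.
  set (m := (2 * n + 1)%nat) in *.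
  enough ((-1) ^ S n * bernoulli_poly (S (S m)) x <= 0)
    by (rewrite <- tech_pow_Rmult; lra).
  apply (convex_nonpos
    (fun x => (-1) ^ S n * bernoulli_poly (S (S m)) x)
    (fun x => (-1) ^ S n * (INR (S (S m)) * bernoulli_poly (S m) x))
    (fun x => INR (S (S m)) * (INR (S m)
                * ((-1) ^ S n * bernoulli_poly m x)))
    0 (1 / 2)); try easy.
  + intros y _. apply is_derive_scal, is_derive_bernoulli_poly.
  + intros y _. evar_last.
    * do 2 apply is_derive_scal. apply is_derive_bernoulli_poly.
    * ring.
  + intros y Hy. apply Rmult_le_pos; [apply pos_INR|].
    apply Rmult_le_pos; [apply pos_INR|now apply IH].
  + cbv beta. replace (S (S m)) with (2 * S n + 1)%nat by lia.
    rewrite odd_bernoulli_poly_0 by lia. ring.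
  + cbv beta. replace (S (S m)) with (2 * S n + 1)%nat by lia.
    rewrite odd_bernoulli_poly_half. ring.
Qed.

(** By the sign of its derivative, B_2k is monotone on [0, 1/2], hence lies
    between its values at 0 and 1/2; the second is 2^(1-2k) - 1 times the
    first.  The symmetry x |-> 1 - x covers [1/2, 1]. *)
Lemma even_bernoulli_poly_bound (k : nat) (x : R) :
  (1 <= k)%nat -> 0 <= x <= 1 ->
  Rabs (bernoulli_poly (2 * k) x) <= Rabs (bernoulli (2 * k)).
Proof.
intros Hk.
assert (Half : forall y, 0 <= y <= 1 / 2 ->
  Rabs (bernoulli_poly (2 * k) y) <= Rabs (bernoulli (2 * k))).
{ intros y Hy. destruct k as [|n]; [lia|].
  replace (2 * S n)%nat with (S (2 * n + 1)) by lia.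
  set (m := (2 * n + 1)%nat). set (s := (-1) ^ S n).
  assert (Mono : forall a b, 0 <= a <= b -> b <= 1 / 2 ->
    s * bernoulli_poly (S m) a <= s * bernoulli_poly (S m) b).
  { intros a b Ha Hb.
    destruct (MVT_closed (fun x => s * bernoulli_poly (S m) x)
      (fun x => s * (INR (S m) * bernoulli_poly m x)) a b) as [c [Hc E]].
    - lra.
    - intros z _. apply is_derive_scal, is_derive_bernoulli_poly.
    - assert (0 <= s * (INR (S m) * bernoulli_poly m c) * (b - a)); [|lra].
      apply Rmult_le_pos; [|lra].
      replace (s * (INR (S m) * bernoulli_poly m c))
        with (INR (S m) * (s * bernoulli_poly m c)) by ring.
      apply Rmult_le_pos; [apply pos_INR|].
      apply odd_bernoulli_poly_sign; lra. }
  assert (L := Mono 0 y ltac:(lra) ltac:(lra)).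
  assert (U := Mono y (1 / 2) ltac:(lra) ltac:(lra)).
  rewrite bernoulli_poly_half, bernoulli_poly_0 in U.
  rewrite bernoulli_poly_0 in L.
  assert (Hs : forall b, Rabs (s * b) = Rabs b).
  { intros b. unfold s. rewrite Rabs_mult, pow_1_abs. ring. }
  rewrite <- Hs, <- (Hs (bernoulli (S m))).
  set (u := s * bernoulli (S m)) in *.
  replace (s * ((2 * (/ 2) ^ S m - 1) * bernoulli (S m)))
    with ((2 * (/ 2) ^ S m - 1) * u) in U by (unfold u; ring).
  assert (P : 0 <= 2 * (/ 2) ^ S m <= 1).
  { rewrite <- tech_pow_Rmult.
    assert (0 < (/ 2) ^ m) by (apply pow_lt; lra).
    assert ((/ 2) ^ m <= 1 ^ m) by (apply pow_incr; lra).
    rewrite pow1 in *. lra. }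
  (* monotonicity from 0 to 1/2 also fixes the sign of the value at 0 *)
  assert (Hu : u <= 0).
  { apply Rnot_lt_le. intros Hu.
    assert (0 <= (1 - 2 * (/ 2) ^ S m) * u) by (apply Rmult_le_pos; lra).
    lra. }
  assert (0 <= (2 * (/ 2) ^ S m) * - u) by (apply Rmult_le_pos; lra).
  rewrite (Rabs_left1 u) by easy. apply Rabs_le. lra. }
intros Hx. destruct (Rle_dec x (1 / 2)) as [H|H]; [apply Half; lra|].
replace (bernoulli_poly (2 * k) x) with (bernoulli_poly (2 * k) (1 - x)).
- apply Half; lra.
- rewrite bernoulli_poly_symm, pow_1_even. ring.
Qed.

(** * The logarithm and its derivatives on the line with imaginary part [t] *)

(** The argument of u + i t for t > 0.  Written with [u / t] rather than
    [t / u], it is smooth across u = 0. *)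
Definition arg_line (t u : R) : R := PI / 2 - atan (u / t).

(** The imaginary part of z log z - z at z = u + i t. *)
Definition arg_primitive (t u : R) : R :=
  t / 2 * ln (u ^ 2 + t ^ 2) + u * arg_line t u - t.

Definition im_inv_pow (p : nat) (t u : R) : R := Im ((/ (u, t)) ^ p)%C.

Lemma sum_sqr_pos (t u : R) : 0 < t -> 0 < u ^ 2 + t ^ 2.
Proof.
intros Ht. assert (H := pow2_ge_0 u).
assert (0 < t ^ 2) by (apply pow_lt; lra). lra.
Qed.

Lemma is_derive_arg_line (t u : R) :
  0 < t -> is_derive (arg_line t) u (im_inv_pow 1 t u).
Proof.
intros Ht. assert (P := sum_sqr_pos t u Ht).
unfold arg_line, im_inv_pow. simpl.
evar_last.
- apply @is_derive_minus; [apply @is_derive_const|].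
  apply (is_derive_comp atan (fun u => u / t)).
  + apply is_derive_atan.
  + apply @is_derive_scal_l, @is_derive_id.
- unfold minus, plus, opp, scal, zero, one; simpl. unfold mult; simpl.
  unfold Rsqr. field. repeat split; try lra; nra.
Qed.

Lemma is_derive_arg_primitive (t u : R) :
  0 < t -> is_derive (arg_primitive t) u (arg_line t u).
Proof.
intros Ht. assert (P := sum_sqr_pos t u Ht).
unfold arg_primitive, arg_line.
auto_derive.
- simpl in P. repeat split; auto; lra.
- change (u * / t) with (u / t). field. repeat split; try lra; nra.
Qed.

Lemma is_derive_inv_pow (p : nat) (t u : R) : 0 < t ->
  is_derive (fun u => Re ((/ (u, t)) ^ p)%C) u
    (- INR p * Re ((/ (u, t)) ^ S p)%C) /\
  is_derive (im_inv_pow p t) u (- INR p * im_inv_pow (S p) t u).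
Proof.
intros Ht. assert (P := sum_sqr_pos t u Ht). unfold im_inv_pow.
induction p as [|p [IHr IHi]].
- split; simpl.
  + replace (- 0 * _) with 0 by ring. exact (is_derive_const 1 u).
  + replace (- 0 * _) with 0 by ring. exact (is_derive_const 0 u).
- assert (Dr : is_derive (fun u => Re (/ (u, t))%C) u
                 (- Re ((/ (u, t)) ^ 2)%C)).
  { simpl. auto_derive; [simpl in P; lra|]. field. lra. }
  assert (Di : is_derive (fun u => Im (/ (u, t))%C) u
                 (- Im ((/ (u, t)) ^ 2)%C)).
  { simpl. auto_derive; [simpl in P; lra|]. field. lra. }
  set (w := (/ (u, t))%C) in *.
  assert (Er : - INR (S p) * Re (w ^ S (S p))%C =
    (- Re (w ^ 2)%C * Re (w ^ p)%C + Re w * (- INR p * Re (w ^ S p)%C)) -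
    (- Im (w ^ 2)%C * Im (w ^ p)%C + Im w * (- INR p * Im (w ^ S p)%C))).
  { rewrite S_INR, !Cpow_S. change (w ^ 0)%C with (RtoC 1).
    generalize w as w', (w ^ p)%C as wp. intros [c d] [a b].
    unfold Re, Im; simpl; ring. }
  assert (Ei : - INR (S p) * Im (w ^ S (S p))%C =
    (- Re (w ^ 2)%C * Im (w ^ p)%C + Re w * (- INR p * Im (w ^ S p)%C)) +
    (- Im (w ^ 2)%C * Re (w ^ p)%C + Im w * (- INR p * Re (w ^ S p)%C))).
  { rewrite S_INR, !Cpow_S. change (w ^ 0)%C with (RtoC 1).
    generalize w as w', (w ^ p)%C as wp. intros [c d] [a b].
    unfold Re, Im; simpl; ring. }
  rewrite Er, Ei. split.
  + apply (is_derive_ext (fun u => Re (/ (u, t))%C * Re ((/ (u, t)) ^ p)%C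
       - Im (/ (u, t))%C * Im ((/ (u, t)) ^ p)%C)); [reflexivity|].
    apply @is_derive_minus; apply Derive.is_derive_mult; assumption.
  + apply (is_derive_ext (fun u => Re (/ (u, t))%C * Im ((/ (u, t)) ^ p)%C
       + Im (/ (u, t))%C * Re ((/ (u, t)) ^ p)%C)); [reflexivity|].
    apply @is_derive_plus; apply Derive.is_derive_mult; assumption.
Qed.

Lemma im_inv_pow_le (p : nat) (t u : R) :
  0 < t -> Rabs (im_inv_pow p t u) <= (/ sqrt (u ^ 2 + t ^ 2)) ^ p.
Proof.
intros Ht. unfold im_inv_pow.
eapply Rle_trans; [eapply Rle_trans; [apply Rmax_r|apply Rmax_Cmod]|].
rewrite Cmod_pow, Cmod_inv; [apply Rle_refl|].
intros E. injection E. lra.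
Qed.

Lemma even_im_inv_pow_le (k : nat) (t u : R) :
  0 < t -> Rabs (im_inv_pow (2 * k) t u) <= / (u ^ 2 + t ^ 2) ^ k.
Proof.
intros Ht. assert (P := sum_sqr_pos t u Ht).
eapply Rle_trans; [apply (im_inv_pow_le _ _ _ Ht)|].
rewrite pow_mult, pow_inv, pow2_sqrt, pow_inv by lra. apply Rle_refl.
Qed.

Lemma im_inv_pow_le_inv (q : nat) (t u : R) :
  0 < t -> 1 <= u -> Rabs (im_inv_pow (S q) t u) <= / u.
Proof.
intros Ht Hu.
eapply Rle_trans; [apply (im_inv_pow_le _ _ _ Ht)|].
assert (L : u <= sqrt (u ^ 2 + t ^ 2)).
{ rewrite <- (sqrt_pow2 u) at 1 by lra. apply sqrt_le_1_alt.
  assert (0 < t ^ 2) by (apply pow_lt; lra). lra. }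
assert (I : / sqrt (u ^ 2 + t ^ 2) <= / u) by (apply Rinv_le_contravar; lra).
assert (J : / u <= 1) by (rewrite <- Rinv_1; apply Rinv_le_contravar; lra).
assert (K : 0 < / sqrt (u ^ 2 + t ^ 2)) by (apply Rinv_0_lt_compat; lra).
rewrite <- tech_pow_Rmult, <- (Rmult_1_r (/ u)).
apply Rmult_le_compat; try lra.
- apply pow_le; lra.
- rewrite <- (pow1 q). apply pow_incr; lra.
Qed.

(** * Euler-Maclaurin summation of the argument *)

(** The function obtained from [arg_line t] by [Q + 1] integrations by parts
    against Bernoulli polynomials in [v].  On an interval where [v - u] is
    constant, its derivative is [arg_line t u] plus a single term of order
    [S Q].  The (q+1)-st derivative of the logarithm is
    (-1)^q q! (u + i t)^-(q+1), which absorbs the alternating signs and the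
    factorials of the usual formula. *)
Fixpoint em_kernel (t : R) (Q : nat) (v u : R) : R :=
  match Q with
  | O => bernoulli_poly 1 v * arg_line t u
  | S q => em_kernel t q v u -
      bernoulli_poly (S Q) v / (INR (S Q) * INR Q) * im_inv_pow Q t u
  end.

Lemma is_derive_em_kernel (t : R) (Q : nat) (c u : R) : 0 < t ->
  is_derive (fun u => em_kernel t Q (u + c) u) u
    (arg_line t u +
     bernoulli_poly (S Q) (u + c) / INR (S Q) * im_inv_pow (S Q) t u).
Proof.
intros Ht.
assert (DB : forall n, is_derive (fun u => bernoulli_poly (S n) (u + c)) u
               (INR (S n) * bernoulli_poly n (u + c))).
{ intros n. evar_last.
  - apply (is_derive_comp (bernoulli_poly (S n)) (fun u => u + c)).
    + apply is_derive_bernoulli_poly.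
    + apply @is_derive_plus; [apply @is_derive_id|apply @is_derive_const].
  - unfold scal, plus, one, zero; simpl. unfold mult; simpl. ring. }
induction Q as [|q IH]; cbn [em_kernel].
- evar_last.
  + apply Derive.is_derive_mult; [apply DB|now apply is_derive_arg_line].
  + rewrite bernoulli_poly_deg0. simpl (INR 1). field.
- set (Q := S q) in *.
  eapply is_derive_Rminus; [apply IH| |].
  + apply Derive.is_derive_mult.
    * apply (is_derive_ext
        (fun u => / (INR (S Q) * INR Q) * bernoulli_poly (S Q) (u + c))).
      { intros y. unfold Rdiv. apply Rmult_comm. }
      apply is_derive_scal. apply DB.
    * now apply is_derive_inv_pow.
  + cbv beta. field.
    split; apply not_0_INR; unfold Q; lia.
Qed.

(** Only B_1 takes different values at 0 and 1; this jump produces the value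
    of the summand at the node. *)
Lemma em_kernel_jump (t : R) (Q : nat) (u : R) :
  em_kernel t Q 1 u - em_kernel t Q 0 u = arg_line t u.
Proof.
induction Q as [|q IH]; cbn [em_kernel].
- rewrite !bernoulli_poly_deg1. field.
- rewrite bernoulli_poly_1 by lia. lra.
Qed.

(** Increments of this function between integers are the Euler-Maclaurin
    approximation of the sum of [arg_line t] over the midpoints in between.
    Its value at 0 is the approximation of theta by t ln t - t and the
    asymptotic terms of order up to [Q]. *)
Definition em_primitive (t : R) (Q : nat) (u : R) : R :=
  arg_primitive t u - em_kernel t Q (1 / 2) u.

(** [w] is a primitive of a bound on the last term of the derivative of
    [em_kernel t Q]; its increments bound the error of the summation formula. *)
Definition em_majorant (t : R) (Q : nat) (w : R -> R) : Prop :=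
  exists dw : R -> R, forall u, 0 <= u ->
    is_derive w u (dw u) /\
    forall v, 0 <= v <= 1 ->
      Rabs (bernoulli_poly (S Q) v / INR (S Q) * im_inv_pow (S Q) t u) <= dw u.

(** The node m + 1/2 splits the unit interval in two.  The argument of the
    Bernoulli polynomials runs from 1/2 to 1 on the first half and from 0 to
    1/2 on the second, so that the pieces match at the integers and jump at
    the node. *)
Lemma em_step (t : R) (Q : nat) (w : R -> R) (m : nat) :
  0 < t -> em_majorant t Q w ->
  Rabs (em_primitive t Q (INR (S m)) - em_primitive t Q (INR m)
        - arg_line t (INR m + 1 / 2)) <= w (INR (S m)) - w (INR m).
Proof.
intros Ht [dw Hw]. assert (Pm := pos_INR m). rewrite S_INR.
assert (D : forall c u, is_derive
  (fun u => arg_primitive t u - em_kernel t Q (u + c) u) u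
  (- (bernoulli_poly (S Q) (u + c) / INR (S Q) * im_inv_pow (S Q) t u))).
{ intros c u. eapply is_derive_Rminus.
  - now apply is_derive_arg_primitive.
  - now apply is_derive_em_kernel.
  - ring. }
assert (B : forall c a b, 0 <= a <= b -> 0 <= a + c -> b + c <= 1 ->
  Rabs ((arg_primitive t b - em_kernel t Q (b + c) b) -
        (arg_primitive t a - em_kernel t Q (a + c) a)) <= w b - w a).
{ intros c a b Hab Ha Hb.
  apply (increment_bound
    (fun u => arg_primitive t u - em_kernel t Q (u + c) u)
    (fun u => - (bernoulli_poly (S Q) (u + c) / INR (S Q)
                 * im_inv_pow (S Q) t u)) w dw).
  - lra.
  - intros x _. apply D.
  - intros x Hx. apply Hw. lra.
  - intros x Hx. rewrite Rabs_Ropp. apply Hw; lra. }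
(* the offsets v - u on the two halves of the interval *)
assert (B1 := B (1 / 2 - INR m) (INR m) (INR m + 1 / 2)
                ltac:(lra) ltac:(lra) ltac:(lra)).
assert (B2 := B (- 1 / 2 - INR m) (INR m + 1 / 2) (INR m + 1)
                ltac:(lra) ltac:(lra) ltac:(lra)).
replace (INR m + 1 / 2 + (1 / 2 - INR m)) with 1 in B1 by field.
replace (INR m + (1 / 2 - INR m)) with (1 / 2) in B1 by field.
replace (INR m + 1 + (- 1 / 2 - INR m)) with (1 / 2) in B2 by field.
replace (INR m + 1 / 2 + (- 1 / 2 - INR m)) with 0 in B2 by field.
assert (E := em_kernel_jump t Q (INR m + 1 / 2)).
unfold em_primitive.
apply Rabs_le_between in B1. apply Rabs_le_between in B2.
apply Rabs_le. lra.
Qed.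

Lemma em_sum (t : R) (Q : nat) (w : R -> R) (n : nat) :
  0 < t -> em_majorant t Q w ->
  Rabs (em_primitive t Q (INR (S n)) - em_primitive t Q 0
        - sum_f_R0 (fun m => arg_line t (INR m + 1 / 2)) n)
  <= w (INR (S n)) - w 0.
Proof.
intros Ht Hw. induction n as [|n IH].
- exact (em_step t Q w 0 Ht Hw).
- assert (H := em_step t Q w (S n) Ht Hw). rewrite tech5.
  apply Rabs_le_between in IH. apply Rabs_le_between in H.
  apply Rabs_le. lra.
Qed.

(** * Passing to the limit *)

Lemma is_lim_seq_inv_S : is_lim_seq (fun n => / INR (S n)) 0.
Proof.
apply (is_lim_seq_incr_1 (fun n => / INR n)).
replace (Finite 0) with (Rbar_inv p_infty) by reflexivity.
apply is_lim_seq_inv; [apply is_lim_seq_INR|easy].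
Qed.

Lemma is_lim_seq_inv_S_bound (u : nat -> R) (c : R) :
  (forall n, Rabs (u n) <= c * / INR (S n)) -> is_lim_seq u 0.
Proof.
intros H. apply is_lim_seq_abs_0.
apply (is_lim_seq_le_le (fun _ => 0) _ (fun n => c * / INR (S n))).
- intros n. split; [apply Rabs_pos|apply H].
- apply is_lim_seq_const.
- replace (Finite 0) with (Rbar_mult c 0) by (simpl; f_equal; ring).
  apply is_lim_seq_scal_l, is_lim_seq_inv_S.
Qed.

Lemma atan_bounds (y : R) : 0 <= y -> y / (1 + y ^ 2) <= atan y <= y.
Proof.
intros Hy.
destruct (MVT_closed atan (fun x => / (1 + x²)) 0 y) as [c [Hc E]]; [easy| |].
- intros x _. apply is_derive_atan.
- rewrite atan_0, !Rminus_0_r in E. rewrite E. unfold Rsqr.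
  assert (c * c <= y * y) by (apply Rmult_le_compat; lra).
  assert (0 <= c * c) by (apply Rmult_le_pos; lra).
  split.
  + unfold Rdiv. rewrite Rmult_comm. apply Rmult_le_compat_r; [easy|].
    apply Rinv_le_contravar; [|simpl]; lra.
  + rewrite <- (Rmult_1_l y) at 2. apply Rmult_le_compat_r; [easy|].
    rewrite <- Rinv_1. apply Rinv_le_contravar; lra.
Qed.

Lemma arg_line_pos_eq (t u : R) : 0 < t -> 0 < u -> arg_line t u = atan (t / u).
Proof.
intros Ht Hu. unfold arg_line. rewrite <- atan_inv.
- f_equal. field. lra.
- now apply Rdiv_lt_0_compat.
Qed.

Lemma is_lim_seq_arg_line (t : R) : 0 < t ->
  is_lim_seq (fun n => arg_line t (INR (S n))) 0.
Proof.
intros Ht. apply is_lim_seq_inv_S_bound with (c := t). intros n.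
assert (H : 0 < INR (S n)) by (apply lt_0_INR; lia).
rewrite arg_line_pos_eq by easy.
destruct (atan_bounds (t / INR (S n))) as [L U].
{ now apply Rlt_le, Rdiv_lt_0_compat. }
rewrite Rabs_pos_eq; [exact U|].
eapply Rle_trans; [|exact L].
apply Rlt_le, Rdiv_lt_0_compat.
- now apply Rdiv_lt_0_compat.
- generalize (pow2_ge_0 (t / INR (S n))). lra.
Qed.

Lemma is_lim_seq_mul_arg_line (t : R) : 0 < t ->
  is_lim_seq (fun n => INR (S n) * arg_line t (INR (S n)) - t) 0.
Proof.
intros Ht. apply is_lim_seq_inv_S_bound with (c := t ^ 3). intros n.
assert (H1 : 1 <= INR (S n)) by (rewrite S_INR; generalize (pos_INR n); lra).
set (u := INR (S n)) in *.
rewrite arg_line_pos_eq by lra.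
assert (P := sum_sqr_pos t u Ht).
destruct (atan_bounds (t / u)) as [L U].
{ apply Rlt_le, Rdiv_lt_0_compat; lra. }
apply (Rmult_le_compat_l u) in L; [|lra].
apply (Rmult_le_compat_l u) in U; [|lra].
replace (u * (t / u / (1 + (t / u) ^ 2))) with (t - t ^ 3 * / (u ^ 2 + t ^ 2))
  in L by (field; split; [nra|lra]).
replace (u * (t / u)) with t in U by (field; lra).
assert (T3 : 0 < t ^ 3) by (apply pow_lt; lra).
assert (t ^ 3 * / (u ^ 2 + t ^ 2) <= t ^ 3 * / u).
{ apply Rmult_le_compat_l; [lra|]. apply Rinv_le_contravar; [lra|].
  assert (0 < t ^ 2) by (apply pow_lt; lra). nra. }
assert (0 < t ^ 3 * / u).
{ apply Rmult_lt_0_compat; [lra|]. apply Rinv_0_lt_compat; lra. }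
apply Rabs_le. lra.
Qed.

(** Inside the logarithm, ((n+1)^2 + t^2) / n^2 is 1 + O(1/n). *)
Lemma is_lim_seq_log_diff (t : R) : 0 < t ->
  is_lim_seq (fun n => t / 2 * ln (INR (S n) ^ 2 + t ^ 2) - t * ln (INR n)) 0.
Proof.
intros Ht. apply is_lim_seq_incr_1.
apply is_lim_seq_inv_S_bound with (c := t / 2 * (3 + t ^ 2)). intros n.
rewrite (S_INR (S n)).
assert (H1 : 1 <= INR (S n)) by (rewrite S_INR; generalize (pos_INR n); lra).
set (u := INR (S n)) in *.
set (x := (2 * u + 1 + t ^ 2) / u ^ 2).
assert (Hu2 : 0 < u ^ 2) by (apply pow_lt; lra).
assert (Ht2 : 0 < t ^ 2) by (apply pow_lt; lra).
assert (Hx : 0 < x) by (apply Rdiv_lt_0_compat; lra).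
replace ((u + 1) ^ 2 + t ^ 2) with (u * u * (1 + x))
  by (unfold x; field; lra).
rewrite !ln_mult by nra.
assert (L : 0 <= ln (1 + x)).
{ rewrite <- ln_1. apply Rcomplements.ln_le; lra. }
assert (U : ln (1 + x) <= x).
{ rewrite <- (ln_exp x) at 2. apply Rcomplements.ln_le; [lra|].
  apply Rlt_le, exp_ineq1. lra. }
assert (X : x <= (3 + t ^ 2) * / u).
{ unfold x. apply Rmult_le_reg_r with (u ^ 2); [lra|].
  replace ((2 * u + 1 + t ^ 2) / u ^ 2 * u ^ 2) with (2 * u + 1 + t ^ 2)
    by (field; lra).
  replace ((3 + t ^ 2) * / u * u ^ 2) with ((3 + t ^ 2) * u) by (field; lra).
  nra. }
replace (t / 2 * (ln u + ln u + ln (1 + x)) - t * ln u)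
  with (t / 2 * ln (1 + x)) by field.
rewrite Rabs_pos_eq by nra.
rewrite Rmult_assoc. apply Rmult_le_compat_l; lra.
Qed.

Lemma is_lim_seq_em_kernel_half (t : R) (Q : nat) : 0 < t ->
  is_lim_seq (fun n => em_kernel t Q (1 / 2) (INR (S n))) 0.
Proof.
intros Ht. induction Q as [|q IH]; cbn [em_kernel].
- apply is_lim_seq_ext with (fun _ => 0); [|apply is_lim_seq_const].
  intros n. rewrite bernoulli_poly_deg1. ring.
- replace (Finite 0) with (Rbar_minus 0 0) by (simpl; f_equal; ring).
  apply is_lim_seq_minus'; [exact IH|].
  set (b := bernoulli_poly _ _ / _).
  apply is_lim_seq_inv_S_bound with (c := Rabs b). intros n.
  rewrite Rabs_mult. apply Rmult_le_compat_l; [apply Rabs_pos|].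
  apply im_inv_pow_le_inv; [easy|].
  rewrite S_INR; generalize (pos_INR n); lra.
Qed.

Lemma is_lim_seq_em_primitive (t : R) (Q : nat) : 0 < t ->
  is_lim_seq (fun n => em_primitive t Q (INR (S n)) - t * ln (INR n)) 0.
Proof.
intros Ht.
apply is_lim_seq_ext with (fun n =>
  (t / 2 * ln (INR (S n) ^ 2 + t ^ 2) - t * ln (INR n)) +
  (INR (S n) * arg_line t (INR (S n)) - t) -
  em_kernel t Q (1 / 2) (INR (S n))).
- intros n. unfold em_primitive, arg_primitive. ring.
- replace (Finite 0) with (Finite (0 + 0 - 0)) by (f_equal; ring).
  apply is_lim_seq_minus'; [apply is_lim_seq_plus'|].
  + now apply is_lim_seq_log_diff.
  + now apply is_lim_seq_mul_arg_line.
  + now apply is_lim_seq_em_kernel_half.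
Qed.

(** The argument of Gauss's product [Gamma_seq] at 1/2 + i t, chosen
    continuously in [t]. *)
Definition theta_seq (t : R) (n : nat) : R :=
  t * ln (INR n) - sum_f_R0 (fun m => arg_line t (INR m + 1 / 2)) n.

(** The error of the summation formula is a series dominated by the
    increments of a convergent sequence; adding that sequence to its partial
    sums makes them monotone and bounded. *)
Lemma ex_lim_theta_seq (t : R) (Q : nat) (w : R -> R) (wl : R) :
  0 < t -> em_majorant t Q w -> is_lim_seq (fun n => w (INR (S n))) wl ->
  exists th : R, is_lim_seq (theta_seq t) th.
Proof.
intros Ht Hw Hl.
set (r := fun n => em_primitive t Q (INR (S n)) - em_primitive t Q 0
            - sum_f_R0 (fun m => arg_line t (INR m + 1 / 2)) n).
assert (C : ex_finite_lim_seq (fun n => r n + w (INR (S n)))).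
{ apply (ex_finite_lim_seq_incr _ (2 * wl - w 0)).
  - intros n. assert (H := em_step t Q w (S n) Ht Hw). unfold r.
    rewrite tech5. apply Rabs_le_between in H. lra.
  - intros n. assert (H := em_sum t Q w n Ht Hw).
    fold (r n) in H. apply Rabs_le_between in H.
    assert (w (INR (S n)) <= wl); [|lra].
    apply (is_lim_seq_incr_compare (fun n => w (INR (S n)))); [easy|].
    intros m. assert (K := em_step t Q w (S m) Ht Hw).
    apply (Rle_trans 0) in K; [lra|apply Rabs_pos]. }
destruct C as [l C].
exists (l - wl + em_primitive t Q 0 - 0).
apply is_lim_seq_ext with (fun n =>
  (r n + w (INR (S n))) - w (INR (S n)) + em_primitive t Q 0
  - (em_primitive t Q (INR (S n)) - t * ln (INR n))).
- intros n. unfold r, theta_seq. ring.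
- apply is_lim_seq_minus'; [|now apply is_lim_seq_em_primitive].
  apply is_lim_seq_plus'; [|apply is_lim_seq_const].
  now apply is_lim_seq_minus'.
Qed.

Lemma theta_limit_bound (t : R) (Q : nat) (w : R -> R) (wl th : R) :
  0 < t -> em_majorant t Q w -> is_lim_seq (fun n => w (INR (S n))) wl ->
  is_lim_seq (theta_seq t) th ->
  Rabs (th - em_primitive t Q 0) <= wl - w 0.
Proof.
intros Ht Hw Hl Hth.
assert (L : is_lim_seq (fun n => Rabs (theta_seq t n +
    (em_primitive t Q (INR (S n)) - t * ln (INR n)) - em_primitive t Q 0))
    (Rabs (th + 0 - em_primitive t Q 0))).
{ apply (is_lim_seq_abs _ (Finite (th + 0 - em_primitive t Q 0))).
  apply is_lim_seq_minus'; [|apply is_lim_seq_const].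
  apply is_lim_seq_plus'; [easy|now apply is_lim_seq_em_primitive]. }
rewrite Rplus_0_r in L.
apply (is_lim_seq_le _ (fun n => w (INR (S n)) - w 0) _ (wl - w 0)) in L.
- exact L.
- intros n. eapply Rle_trans; [|apply (em_sum t Q w n Ht Hw)].
  right. f_equal. unfold theta_seq. ring.
- apply is_lim_seq_minus'; [easy|apply is_lim_seq_const].
Qed.

(** * Majorants of the error *)

(** The integral from 0 to [u] of dx / (x^2 + t^2)^(i+1), by the reduction
    formula that integration by parts gives. *)
Fixpoint kernel_integral (t : R) (i : nat) (u : R) : R :=
  match i with
  | O => atan (u / t) / t
  | S j => (INR (2 * j + 1) * kernel_integral t j u + u / (u ^ 2 + t ^ 2) ^ S j)
           / (2 * INR (S j) * t ^ 2)
  end.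

Fixpoint kernel_integral_limit (t : R) (i : nat) : R :=
  match i with
  | O => PI / 2 / t
  | S j => INR (2 * j + 1) * kernel_integral_limit t j / (2 * INR (S j) * t ^ 2)
  end.

Lemma is_derive_kernel_integral (t : R) (i : nat) (u : R) : 0 < t ->
  is_derive (kernel_integral t i) u (/ (u ^ 2 + t ^ 2) ^ S i).
Proof.
intros Ht. assert (P := sum_sqr_pos t u Ht).
assert (T2 : 0 < t ^ 2) by (apply pow_lt; lra).
induction i as [|j IH].
- unfold kernel_integral. auto_derive; [lra|]. field.
  repeat split; try lra; nra.
- assert (D : is_derive (fun u => u / (u ^ 2 + t ^ 2) ^ S j) u
    (/ (u ^ 2 + t ^ 2) ^ S j
     - 2 * INR (S j) * u ^ 2 / (u ^ 2 + t ^ 2) ^ S (S j))).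
  { remember (S j) as n eqn:En.
    auto_derive; [apply pow_nonzero; simpl in P; lra|].
    rewrite En. cbn [Nat.pred].
    replace (u * (u * 1) + t * (t * 1)) with (u ^ 2 + t ^ 2) by ring.
    set (X := u ^ 2 + t ^ 2) in *. set (c := INR (S j)).
    cbn [pow]. field. split; [apply pow_nonzero|]; lra. }
  apply (is_derive_ext (fun u => / (2 * INR (S j) * t ^ 2) *
    (INR (2 * j + 1) * kernel_integral t j u + u / (u ^ 2 + t ^ 2) ^ S j))).
  { intros y. cbn [kernel_integral]. unfold Rdiv. apply Rmult_comm. }
  evar_last.
  + apply is_derive_scal, @is_derive_plus.
    * apply is_derive_scal, IH.
    * exact D.
  + unfold plus; simpl AbelianGroup.sort.
    change (/ (2 * INR (S j) * t ^ 2) *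
      (INR (2 * j + 1) * / (u ^ 2 + t ^ 2) ^ S j +
       (/ (u ^ 2 + t ^ 2) ^ S j
        - 2 * INR (S j) * u ^ 2 / (u ^ 2 + t ^ 2) ^ S (S j)))
      = / (u ^ 2 + t ^ 2) ^ S (S j)).
    rewrite S_INR, plus_INR, mult_INR. simpl (INR 2). simpl (INR 1).
    generalize (pos_INR j); intros Hj. cbn [pow].
    field. repeat split; try apply pow_nonzero; lra.
Qed.

Lemma kernel_integral_0 (t : R) (i : nat) : kernel_integral t i 0 = 0.
Proof.
induction i as [|j IH]; cbn [kernel_integral].
- unfold Rdiv. rewrite Rmult_0_l, atan_0. ring.
- rewrite IH. unfold Rdiv. ring.
Qed.

Lemma is_lim_seq_kernel_integral (t : R) (i : nat) : 0 < t ->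
  is_lim_seq (fun n => kernel_integral t i (INR (S n)))
    (kernel_integral_limit t i).
Proof.
intros Ht. induction i as [|j IH]; cbn [kernel_integral kernel_integral_limit].
- apply is_lim_seq_ext with
    (fun n => / t * (PI / 2 - arg_line t (INR (S n)))).
  { intros n. unfold arg_line, Rdiv. ring. }
  replace (Finite (PI / 2 / t)) with (Rbar_mult (/ t) (Finite (PI / 2 - 0)))
    by (simpl; f_equal; field; lra).
  apply is_lim_seq_scal_l, is_lim_seq_minus'; [apply is_lim_seq_const|].
  now apply is_lim_seq_arg_line.
- set (d := 2 * INR (S j) * t ^ 2).
  apply is_lim_seq_ext with (fun n => / d *
    (INR (2 * j + 1) * kernel_integral t j (INR (S n))
     + INR (S n) / (INR (S n) ^ 2 + t ^ 2) ^ S j)).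
  { intros n. unfold Rdiv. apply Rmult_comm. }
  replace (Finite (INR (2 * j + 1) * kernel_integral_limit t j / d))
    with (Rbar_mult (/ d)
            (Finite (INR (2 * j + 1) * kernel_integral_limit t j + 0)))
    by (simpl; f_equal; rewrite Rplus_0_r; apply Rmult_comm).
  apply is_lim_seq_scal_l, is_lim_seq_plus'.
  + apply (is_lim_seq_scal_l _ _ (Finite (kernel_integral_limit t j))), IH.
  + apply is_lim_seq_inv_S_bound with (c := 1). intros n.
    assert (H : 1 <= INR (S n)) by (rewrite S_INR; generalize (pos_INR n); lra).
    set (u := INR (S n)) in *. assert (P := sum_sqr_pos t u Ht).
    assert (T2 : 0 < t ^ 2) by (apply pow_lt; lra).
    assert (X : u ^ 2 <= (u ^ 2 + t ^ 2) ^ S j).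
    { change (u ^ 2 <= (u ^ 2 + t ^ 2) * (u ^ 2 + t ^ 2) ^ j).
      rewrite <- (Rmult_1_r (u ^ 2)) at 1.
      apply Rmult_le_compat; try lra; [apply pow2_ge_0|].
      rewrite <- (pow1 j). apply pow_incr. nra. }
    assert (0 < u ^ 2) by (apply pow_lt; lra).
    rewrite Rabs_pos_eq.
    2:{ apply Rlt_le, Rdiv_lt_0_compat; lra. }
    apply Rle_trans with (u * / u ^ 2).
    * apply Rmult_le_compat_l; [lra|]. apply Rinv_le_contravar; lra.
    * right. field. lra.
Qed.

(** With no correction term the error involves B_1(v) = v - 1/2, at most 1/2,
    and the derivative of the argument, which has constant sign. *)
Lemma em_majorant_order_1 (t : R) :
  0 < t -> em_majorant t 0 (fun u => - / 2 * arg_line t u).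
Proof.
intros Ht. exists (fun u => - / 2 * im_inv_pow 1 t u). intros u Hu. split.
- apply is_derive_scal. now apply is_derive_arg_line.
- intros v Hv. rewrite bernoulli_poly_deg1. simpl (INR 1).
  assert (P := sum_sqr_pos t u Ht).
  assert (Y : im_inv_pow 1 t u = - (t / (u ^ 2 + t ^ 2))).
  { unfold im_inv_pow. simpl. field. simpl in P. lra. }
  assert (0 < t / (u ^ 2 + t ^ 2)) by now apply Rdiv_lt_0_compat.
  rewrite Y, Rabs_mult, Rabs_Ropp, (Rabs_pos_eq (t / _)) by lra.
  replace (- / 2 * - (t / (u ^ 2 + t ^ 2))) with (/ 2 * (t / (u ^ 2 + t ^ 2)))
    by ring.
  apply Rmult_le_compat_r; [lra|]. apply Rabs_le. lra.
Qed.

(** The order of the last term is 2 (i+1); only here is the sharp bound on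
    Bernoulli polynomials of even index needed. *)
Lemma em_majorant_even (t : R) (i : nat) : 0 < t ->
  em_majorant t (2 * i + 1)
    (fun u => Rabs (bernoulli (2 * S i)) / INR (2 * S i)
              * kernel_integral t i u).
Proof.
intros Ht.
exists (fun u => Rabs (bernoulli (2 * S i)) / INR (2 * S i)
                 * / (u ^ 2 + t ^ 2) ^ S i).
replace (S (2 * i + 1)) with (2 * S i)%nat by lia.
intros u Hu. split.
- apply is_derive_scal. now apply is_derive_kernel_integral.
- intros v Hv. rewrite Rabs_mult. unfold Rdiv. rewrite Rabs_mult.
  assert (0 < INR (2 * S i)) by (apply lt_0_INR; lia).
  rewrite (Rabs_pos_eq (/ _)) by (now apply Rlt_le, Rinv_0_lt_compat).
  apply Rmult_le_compat; try apply Rabs_pos.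
  + apply Rmult_le_pos; [apply Rabs_pos|now apply Rlt_le, Rinv_0_lt_compat].
  + apply Rmult_le_compat_r; [now apply Rlt_le, Rinv_0_lt_compat|].
    apply even_bernoulli_poly_bound; [lia|easy].
  + now apply even_im_inv_pow_le.
Qed.

(** * Gauss's product on the line with real part one half *)

Definition critical_line_mod (t : R) (m : nat) : R :=
  sqrt ((INR m + 1 / 2) ^ 2 + t ^ 2).

Definition gamma_mod (t : R) (n : nat) : R :=
  INR (fact n) * sqrt (INR n) / prod_f_R0 (critical_line_mod t) n.

Lemma critical_line_mod_pos (t : R) (m : nat) :
  0 < t -> 0 < critical_line_mod t m.
Proof. intros Ht. apply sqrt_lt_R0, sum_sqr_pos, Ht. Qed.

Lemma prod_critical_line_mod_pos (t : R) (n : nat) :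
  0 < t -> 0 < prod_f_R0 (critical_line_mod t) n.
Proof.
intros Ht. induction n as [|n IH]; simpl.
- now apply critical_line_mod_pos.
- apply Rmult_lt_0_compat; [easy|now apply critical_line_mod_pos].
Qed.

Lemma critical_line_polar (t : R) (m : nat) : 0 < t ->
  Cplus (1 / 2, t) (RtoC (INR m)) =
  (critical_line_mod t m * cos (arg_line t (INR m + 1 / 2)),
   critical_line_mod t m * sin (arg_line t (INR m + 1 / 2))).
Proof.
intros Ht. unfold arg_line, critical_line_mod.
set (u := INR m + 1 / 2). assert (P := sum_sqr_pos t u Ht).
rewrite cos_shift, sin_shift, sin_atan, cos_atan.
replace (1 + (u / t)²) with ((u ^ 2 + t ^ 2) / t ^ 2)
  by (unfold Rsqr; field; lra).
rewrite sqrt_div_alt, sqrt_pow2 by (try apply pow_lt; lra).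
assert (S : 0 < sqrt (u ^ 2 + t ^ 2)) by now apply sqrt_lt_R0.
unfold Cplus, RtoC; cbn [fst snd].
replace (1 / 2 + INR m) with u by (unfold u; ring).
f_equal; field; lra.
Qed.

Lemma rising_critical_line_polar (t : R) (n : nat) : 0 < t ->
  let r := prod_f_R0 (critical_line_mod t) n in
  let a := sum_f_R0 (fun m => arg_line t (INR m + 1 / 2)) n in
  rising (1 / 2, t)%R (S n) = (r * cos a, r * sin a).
Proof.
intros Ht. cbv zeta. induction n as [|n IH].
- cbn [rising prod_f_R0 sum_f_R0]. rewrite critical_line_polar by easy.
  apply Cmult_1_l.
- cbn [rising] in IH |- *. rewrite IH, critical_line_polar by easy.
  cbn [prod_f_R0 sum_f_R0]. rewrite cos_plus, sin_plus.
  unfold Cmult; cbn [fst snd]. f_equal; ring.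
Qed.

Lemma exp_half_ln (x : R) : 0 < x -> exp (1 / 2 * ln x) = sqrt x.
Proof.
intros Hx. rewrite <- Rpower_sqrt by easy. unfold Rpower. f_equal. field.
Qed.

Lemma Gamma_seq_critical_line (t : R) (n : nat) : 0 < t ->
  Gamma_seq (1 / 2, t)%R (S n) =
  (gamma_mod t (S n) * cos (theta_seq t (S n)),
   gamma_mod t (S n) * sin (theta_seq t (S n))).
Proof.
intros Ht. unfold Gamma_seq. rewrite rising_critical_line_polar by easy.
unfold gamma_mod, theta_seq.
assert (Q := prod_critical_line_mod_pos t (S n) Ht).
set (r := prod_f_R0 _ _) in *.
set (a := sum_f_R0 _ _). rewrite cos_minus, sin_minus.
assert (E : Cexp (Cmult (1 / 2, t) (RtoC (ln (INR (S n))))) =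
  (sqrt (INR (S n)) * cos (t * ln (INR (S n))),
   sqrt (INR (S n)) * sin (t * ln (INR (S n))))).
{ unfold Cexp, Cmult, Re, Im, RtoC. cbn [fst snd].
  rewrite !Rmult_0_r, Rminus_0_r, Rplus_0_l, exp_half_ln; [easy|].
  apply lt_0_INR. lia. }
rewrite E.
assert (CS : cos a ^ 2 + sin a ^ 2 = 1).
{ generalize (sin2_cos2 a). unfold Rsqr. lra. }
assert (N : (r * cos a) ^ 2 + (r * sin a) ^ 2 = r ^ 2).
{ replace ((r * cos a) ^ 2 + (r * sin a) ^ 2)
    with (r ^ 2 * (cos a ^ 2 + sin a ^ 2)) by ring. rewrite CS. ring. }
unfold Cdiv, Cmult, Cinv, RtoC. cbn [fst snd].
rewrite N. f_equal; field; lra.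
Qed.

(** The modulus of Gauss's product is eventually monotone, but in a direction
    that depends on [t].  Multiplied by 1 + 1/n it is nonincreasing for all
    [t]; this comes down to (n+2)^2 n <= (n+1) ((n+3/2)^2 + t^2). *)
Lemma ex_lim_gamma_mod (t : R) : 0 < t ->
  exists r : R, 0 <= r /\ is_lim_seq (gamma_mod t) r.
Proof.
intros Ht.
assert (Pos : forall n, 0 <= gamma_mod t n).
{ intros n. apply Rmult_le_pos.
  - apply Rmult_le_pos; [apply pos_INR|apply sqrt_pos].
  - apply Rlt_le, Rinv_0_lt_compat. now apply prod_critical_line_mod_pos. }
assert (X : ex_finite_lim_seq
  (fun n => gamma_mod t (S n) * (1 + / INR (S n)))).
{ apply (ex_finite_lim_seq_decr _ 0).
  - intros n. set (u := INR (S n)).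
    assert (Hu : 1 <= u) by (unfold u; rewrite S_INR;
      generalize (pos_INR n); lra).
    unfold gamma_mod. cbn [prod_f_R0].
    rewrite (fact_simpl (S n)), mult_INR, (S_INR (S n)). fold u.
    assert (Q := prod_critical_line_mod_pos t (S n) Ht). cbn [prod_f_R0] in Q.
    set (p := prod_f_R0 _ n * _) in *.
    assert (R1 := critical_line_mod_pos t (S (S n)) Ht).
    assert (R2 : critical_line_mod t (S (S n)) ^ 2 = (u + 3 / 2) ^ 2 + t ^ 2).
    { unfold critical_line_mod. rewrite pow2_sqrt.
      - rewrite (S_INR (S n)). fold u. field.
      - apply Rlt_le, sum_sqr_pos, Ht. }
    set (h := critical_line_mod t (S (S n))) in *.
    assert (K : sqrt (u + 1) * (u + 2) * u <= sqrt u * (u + 1) * h).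
    { assert (S0 := sqrt_pos u).
      apply Rsqr_incr_0_var.
      - unfold Rsqr.
        replace (sqrt (u + 1) * (u + 2) * u * (sqrt (u + 1) * (u + 2) * u))
          with (sqrt (u + 1) * sqrt (u + 1) * ((u + 2) * u) ^ 2) by ring.
        replace (sqrt u * (u + 1) * h * (sqrt u * (u + 1) * h))
          with (sqrt u * sqrt u * (u + 1) ^ 2 * h ^ 2) by ring.
        rewrite R2, !sqrt_sqrt by lra.
        replace ((u + 1) * ((u + 2) * u) ^ 2)
          with (u * (u + 1) * ((u + 2) ^ 2 * u)) by ring.
        replace (u * (u + 1) ^ 2 * ((u + 3 / 2) ^ 2 + t ^ 2))
          with (u * (u + 1) * ((u + 1) * ((u + 3 / 2) ^ 2 + t ^ 2))) by ring.
        apply Rmult_le_compat_l; [nra|].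
        assert (0 < t ^ 2) by (apply pow_lt; lra).
        assert (0 <= (u + 1) * t ^ 2) by (apply Rmult_le_pos; lra).
        nra.
      - apply Rmult_le_pos; [apply Rmult_le_pos|]; lra. }
    assert (F : 0 < INR (fact (S n))) by apply INR_fact_lt_0.
    set (f := INR (fact (S n))) in *.
    replace ((u + 1) * f * sqrt (u + 1) / (p * h) * (1 + / (u + 1)))
      with (f / (p * h * u) * (sqrt (u + 1) * (u + 2) * u))
      by (field; lra).
    replace (f * sqrt u / p * (1 + / u))
      with (f / (p * h * u) * (sqrt u * (u + 1) * h)) by (field; lra).
    apply Rmult_le_compat_l; [|easy].
    apply Rlt_le, Rdiv_lt_0_compat; [easy|].
    apply Rmult_lt_0_compat; [now apply Rmult_lt_0_compat|lra].
  - intros n. apply Rmult_le_pos; [apply Pos|].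
    assert (0 < / INR (S n)); [|lra].
    apply Rinv_0_lt_compat, lt_0_INR. lia. }
destruct X as [r Hr].
assert (L : is_lim_seq (fun n => gamma_mod t (S n)) (r / (1 + 0))).
{ apply is_lim_seq_ext with
    (fun n => gamma_mod t (S n) * (1 + / INR (S n)) / (1 + / INR (S n))).
  - intros n. assert (0 < INR (S n)) by (apply lt_0_INR; lia).
    assert (0 < / INR (S n)) by now apply Rinv_0_lt_compat.
    field. lra.
  - apply is_lim_seq_div'; [easy| |lra].
    apply is_lim_seq_plus'; [apply is_lim_seq_const|apply is_lim_seq_inv_S]. }
exists (r / (1 + 0)). split; [|now apply is_lim_seq_incr_1].
apply (is_lim_seq_le (fun _ => 0) _ 0 (r / (1 + 0)))
  with (2 := is_lim_seq_const 0) (3 := L).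
intros n. apply Pos.
Qed.

(** The modulus [r] is only shown to be nonnegative: that it is not 0 follows
    later from Gamma being an exponential. *)
Lemma Gamma_critical_line (t th : R) :
  0 < t -> is_lim_seq (theta_seq t) th ->
  exists r, 0 <= r /\ Gamma (1 / 2, t)%R = (r * cos th, r * sin th).
Proof.
intros Ht Hth. destruct (ex_lim_gamma_mod t Ht) as [r [Hr Lr]].
exists r. split; [easy|].
apply is_lim_seq_incr_1 in Hth. apply is_lim_seq_incr_1 in Lr.
assert (Lc : is_lim_seq (fun n => Re (Gamma_seq (1 / 2, t)%R n)) (r * cos th)).
{ apply is_lim_seq_incr_1.
  apply is_lim_seq_ext with
    (fun n => gamma_mod t (S n) * cos (theta_seq t (S n))).
  { intros n. now rewrite Gamma_seq_critical_line. }
  apply is_lim_seq_mult'; [easy|].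
  apply is_lim_seq_continuous; [apply continuity_cos|easy]. }
assert (Ls : is_lim_seq (fun n => Im (Gamma_seq (1 / 2, t)%R n)) (r * sin th)).
{ apply is_lim_seq_incr_1.
  apply is_lim_seq_ext with
    (fun n => gamma_mod t (S n) * sin (theta_seq t (S n))).
  { intros n. now rewrite Gamma_seq_critical_line. }
  apply is_lim_seq_mult'; [easy|].
  apply is_lim_seq_continuous; [apply continuity_sin|easy]. }
unfold Gamma.
now rewrite (is_lim_seq_unique _ _ Lc), (is_lim_seq_unique _ _ Ls).
Qed.

(** * Wallis and the values of Gamma at half-integers *)

Definition wallis (n : nat) : R := RInt (fun x => sin x ^ n) 0 (PI / 2).

Lemma is_RInt_wallis (n : nat) :
  is_RInt (fun x => sin x ^ n) 0 (PI / 2) (wallis n).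
Proof.
apply (RInt_correct (V := R_CompleteNormedModule)), ex_RInt_continuous.
intros x _. apply (ex_derive_continuous (V := R_NormedModule)).
auto_derive. easy.
Qed.

Lemma wallis_0 : wallis 0 = PI / 2.
Proof.
unfold wallis. simpl. rewrite RInt_const. unfold scal; simpl.
unfold mult; simpl. ring.
Qed.

Lemma wallis_1 : wallis 1 = 1.
Proof.
apply is_RInt_unique.
replace 1 with (minus (- cos (PI / 2)) (- cos 0))
  by (rewrite cos_PI2, cos_0; unfold minus, plus, opp; simpl; ring).
apply (is_RInt_derive (fun x => - cos x)).
- intros x _. auto_derive; [easy|ring].
- intros x _. apply (ex_derive_continuous (V := R_NormedModule)).
  auto_derive. easy.
Qed.

(** Integrate the derivative of - cos x * sin x ^ (n+1), which vanishes at
    both ends. *)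
Lemma wallis_rec (n : nat) :
  INR (S (S n)) * wallis (S (S n)) = INR (S n) * wallis n.
Proof.
set (a := INR (S (S n))). set (b := INR (S n)).
set (f := fun x => a * sin x ^ S (S n) - b * sin x ^ n).
assert (I1 : is_RInt f 0 (PI / 2) (a * wallis (S (S n)) - b * wallis n)).
{ exact (is_RInt_minus (V := R_NormedModule) _ _ _ _ _ _
    (is_RInt_scal (V := R_NormedModule) _ _ _ a _ (is_RInt_wallis _))
    (is_RInt_scal (V := R_NormedModule) _ _ _ b _ (is_RInt_wallis _))). }
assert (I2 : is_RInt f 0 (PI / 2)
  (- cos (PI / 2) * sin (PI / 2) ^ S n - - cos 0 * sin 0 ^ S n)).
{ apply (is_RInt_derive (V := R_CompleteNormedModule)
    (fun x => - cos x * sin x ^ S n)).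
  - intros x _. unfold f.
    replace (a * sin x ^ S (S n) - b * sin x ^ n)
      with (sin x * sin x ^ S n + - cos x * (b * cos x * sin x ^ n)).
    + apply (Derive.is_derive_mult (fun x => - cos x) (fun x => sin x ^ S n)
        x (sin x) (b * cos x * sin x ^ n)).
      * auto_derive; [easy|ring].
      * apply (is_derive_pow sin (S n) x (cos x)).
        apply is_derive_Reals, derivable_pt_lim_sin.
    + assert (E := sin2_cos2 x). unfold Rsqr in E.
      unfold a. rewrite (S_INR (S n)). fold b. cbn [pow].
      replace (- cos x * (b * cos x * sin x ^ n))
        with (- b * sin x ^ n * (1 - sin x * sin x))
        by (rewrite <- E; ring).
      ring.
  - intros x _. apply (ex_derive_continuous (V := R_NormedModule)).
    unfold f. auto_derive. easy. }
apply (is_RInt_unique (V := R_CompleteNormedModule)) in I1.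
apply (is_RInt_unique (V := R_CompleteNormedModule)) in I2.
rewrite I1, cos_PI2, sin_0, pow_i in I2 by lia. lra.
Qed.

Lemma wallis_pos (n : nat) : 0 < wallis n.
Proof.
assert (H : 0 < wallis n /\ 0 < wallis (S n)); [|easy].
induction n as [|n [H0 H1]].
- rewrite wallis_0, wallis_1. split; [apply PI2_RGT_0|lra].
- split; [easy|]. assert (E := wallis_rec n).
  assert (P1 : 0 < INR (S (S n))) by (apply lt_0_INR; lia).
  assert (P2 : 0 < INR (S n)) by (apply lt_0_INR; lia).
  apply Rmult_lt_reg_l with (INR (S (S n))); [easy|].
  rewrite Rmult_0_r, E. now apply Rmult_lt_0_compat.
Qed.

Lemma wallis_decr (n : nat) : wallis (S n) <= wallis n.
Proof.
assert (P := PI2_RGT_0).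
apply (is_RInt_le (fun x => sin x ^ S n) (fun x => sin x ^ n) 0 (PI / 2));
  try apply is_RInt_wallis; [lra|].
intros x Hx.
assert (0 <= sin x) by (apply sin_ge_0; lra).
assert (sin x <= 1) by apply SIN_bound.
assert (0 <= sin x ^ n) by now apply pow_le.
simpl. nra.
Qed.

Lemma wallis_mult (n : nat) : INR (S n) * wallis n * wallis (S n) = PI / 2.
Proof.
induction n as [|n IH].
- rewrite wallis_0, wallis_1. simpl. ring.
- rewrite (Rmult_comm (INR _)), Rmult_assoc, wallis_rec, <- IH. ring.
Qed.

(** Gauss's product on the positive reals. *)
Definition gamma_real_seq (x : R) (n : nat) : R :=
  INR (fact n) * exp (x * ln (INR n)) / prod_f_R0 (fun m => x + INR m) n.

Lemma prod_shift_pos (x : R) (n : nat) :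
  0 < x -> 0 < prod_f_R0 (fun m => x + INR m) n.
Proof.
intros Hx. induction n as [|n IH]; cbn [prod_f_R0].
- simpl. lra.
- apply Rmult_lt_0_compat; [easy|]. generalize (pos_INR (S n)). lra.
Qed.

Lemma Gamma_seq_real (x : R) (n : nat) :
  0 < x -> Gamma_seq (RtoC x) n = RtoC (gamma_real_seq x n).
Proof.
intros Hx.
assert (R : rising (RtoC x) (S n) = RtoC (prod_f_R0 (fun m => x + INR m) n)).
{ induction n as [|n IH].
  - cbn [rising prod_f_R0]. rewrite <- RtoC_plus. apply Cmult_1_l.
  - cbn [rising] in IH |- *. rewrite IH. cbn [prod_f_R0].
    now rewrite RtoC_mult, RtoC_plus. }
unfold Gamma_seq, gamma_real_seq. rewrite R.
assert (E : Cexp (RtoC x * RtoC (ln (INR n))) = RtoC (exp (x * ln (INR n)))).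
{ rewrite <- RtoC_mult. unfold Cexp, RtoC, Re, Im. cbn [fst snd].
  rewrite cos_0, sin_0. f_equal; ring. }
rewrite E, RtoC_div, RtoC_mult; [reflexivity|].
apply Rgt_not_eq. now apply prod_shift_pos.
Qed.

Lemma Gamma_R_lim (x l : R) :
  0 < x -> is_lim_seq (gamma_real_seq x) l -> Gamma_R x = l.
Proof.
intros Hx Hl. unfold Gamma_R, Gamma. cbn [fst Re].
rewrite (Lim_seq_ext _ (gamma_real_seq x)).
- unfold Re; cbn [fst]. now rewrite (is_lim_seq_unique _ _ Hl).
- intros n. now rewrite Gamma_seq_real.
Qed.

Lemma gamma_real_seq_shift (x : R) (n : nat) : 0 < x ->
  gamma_real_seq (x + 1) (S n) =
  gamma_real_seq x (S n) * (x * / (1 + (x + 1) * / INR (S n))).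
Proof.
intros Hx.
assert (Sh : forall k, x * prod_f_R0 (fun m => x + 1 + INR m) k =
                prod_f_R0 (fun m => x + INR m) k * (x + 1 + INR k)).
{ induction k as [|k IH]; [simpl; ring|].
  cbn [prod_f_R0]. rewrite <- Rmult_assoc, IH, S_INR. ring. }
assert (Hn : 0 < INR (S n)) by (apply lt_0_INR; lia).
unfold gamma_real_seq. specialize (Sh (S n)).
assert (P1 := prod_shift_pos x (S n) Hx).
assert (P2 := prod_shift_pos (x + 1) (S n) ltac:(lra)).
rewrite Rmult_plus_distr_r, exp_plus, Rmult_1_l, exp_ln by easy.
set (u := INR (S n)) in *. set (e := exp _).
set (p := prod_f_R0 (fun m => x + INR m) (S n)) in *.
set (q := prod_f_R0 (fun m => x + 1 + INR m) (S n)) in *.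
replace q with (p * (x + 1 + u) / x) by (rewrite <- Sh; field; lra).
field. lra.
Qed.

(** The product n! / ((1/2) (3/2) ... (n + 1/2)) satisfies the same recursion
    as the odd Wallis integrals. *)
Lemma gamma_real_seq_half (n : nat) :
  gamma_real_seq (1 / 2) (S n) = 2 * sqrt (INR (S n)) * wallis (2 * S n + 1).
Proof.
unfold gamma_real_seq. rewrite exp_half_ln by (apply lt_0_INR; lia).
enough (E : forall k, INR (fact k) / prod_f_R0 (fun m => 1 / 2 + INR m) k
              = 2 * wallis (2 * k + 1)).
{ unfold Rdiv. replace (2 * sqrt (INR (S n)) * wallis (2 * S n + 1))
    with (sqrt (INR (S n)) * (2 * wallis (2 * S n + 1))) by ring.
  rewrite <- E. unfold Rdiv. ring. }
induction k as [|k IH].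
- change (2 * 0 + 1)%nat with 1%nat. rewrite wallis_1. simpl. field.
- assert (W := wallis_rec (2 * k + 1)).
  replace (S (S (2 * k + 1))) with (2 * S k + 1)%nat in W by lia.
  assert (Pk := pos_INR k).
  assert (Q := prod_shift_pos (1 / 2) k ltac:(lra)).
  cbn [prod_f_R0]. rewrite fact_simpl, mult_INR.
  replace (INR (2 * S k + 1)) with (2 * (1 / 2 + INR (S k))) in W
    by (rewrite plus_INR, mult_INR; simpl (INR 2); simpl (INR 1); field).
  replace (INR (S (2 * k + 1))) with (2 * INR (S k)) in W
    by (rewrite !S_INR, plus_INR, mult_INR; simpl (INR 2); simpl (INR 1); ring).
  replace (wallis (2 * S k + 1))
    with (INR (S k) * wallis (2 * k + 1) / (1 / 2 + INR (S k))).
  + replace (wallis (2 * k + 1)) with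
      (INR (fact k) / prod_f_R0 (fun m => 1 / 2 + INR m) k / 2)
      by (rewrite IH; field).
    field. generalize (pos_INR (S k)). lra.
  + assert (0 <= INR (S k)) by apply pos_INR.
    apply Rmult_eq_reg_l with (2 * (1 / 2 + INR (S k))); [|lra].
    rewrite W. field. lra.
Qed.

(** Consecutive Wallis integrals have the product PI / (2 (n+1)) and are
    decreasing, which squeezes the square of the odd one. *)
Lemma is_lim_gamma_real_seq_half :
  is_lim_seq (gamma_real_seq (1 / 2)) (sqrt PI).
Proof.
apply is_lim_seq_incr_1.
assert (Pi := PI_RGT_0).
assert (B : forall n, PI * / (1 + / INR (S n))
              <= gamma_real_seq (1 / 2) (S n) ^ 2 <= PI).
{ intros n. rewrite gamma_real_seq_half.
  set (m := (2 * S n)%nat). replace (m + 1)%nat with (S m) by lia.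
  assert (Hu : 0 < INR (S n)) by (apply lt_0_INR; lia).
  replace ((2 * sqrt (INR (S n)) * wallis (S m)) ^ 2)
    with (4 * (sqrt (INR (S n)) * sqrt (INR (S n))) * wallis (S m) ^ 2) by ring.
  rewrite sqrt_sqrt by lra.
  assert (Em : INR m = 2 * INR (S n))
    by (unfold m; rewrite mult_INR; simpl (INR 2); ring).
  assert (M1 := wallis_mult m). assert (M2 := wallis_mult (S m)).
  rewrite !S_INR, Em in M1. rewrite !S_INR, Em in M2.
  assert (D1 := wallis_decr m). assert (D2 := wallis_decr (S m)).
  assert (W := wallis_pos (S m)).
  set (u := INR (S n)) in *.
  assert (Iu : 0 < / u) by now apply Rinv_0_lt_compat.
  set (w0 := wallis m) in *. set (w1 := wallis (S m)) in *.
  set (w2 := wallis (S (S m))) in *.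
  assert (L1 : w1 ^ 2 <= w0 * w1) by nra.
  assert (L2 : w1 * w2 <= w1 ^ 2) by nra.
  split.
  - apply Rmult_le_reg_r with (1 + / u); [lra|].
    replace (PI * / (1 + / u) * (1 + / u)) with PI by (field; lra).
    replace (4 * u * w1 ^ 2 * (1 + / u)) with (2 * (2 * u + 2) * w1 ^ 2)
      by (field; lra).
    nra.
  - nra. }
assert (Pos : forall n, 0 <= gamma_real_seq (1 / 2) (S n)).
{ intros n. rewrite gamma_real_seq_half.
  assert (H := sqrt_pos (INR (S n))). assert (W := wallis_pos (2 * S n + 1)).
  apply Rmult_le_pos; lra. }
apply is_lim_seq_ext with
  (fun n => sqrt (gamma_real_seq (1 / 2) (S n) ^ 2)).
{ intros n. now apply sqrt_pow2. }
apply is_lim_seq_continuous; [apply continuity_pt_sqrt; lra|].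
apply (is_lim_seq_le_le _ _ _ _ B); [|apply is_lim_seq_const].
replace (Finite PI) with (Finite (PI / (1 + 0))) by (f_equal; field).
apply (is_lim_seq_div' (fun _ => PI)); [apply is_lim_seq_const| |lra].
apply is_lim_seq_plus'; [apply is_lim_seq_const|apply is_lim_seq_inv_S].
Qed.

Lemma is_lim_gamma_real_seq_succ (x l : R) :
  0 < x -> is_lim_seq (gamma_real_seq x) l ->
  is_lim_seq (gamma_real_seq (x + 1)) (l * x).
Proof.
intros Hx Hl. apply is_lim_seq_incr_1. apply is_lim_seq_incr_1 in Hl.
eapply is_lim_seq_ext; [intros n; symmetry; now apply gamma_real_seq_shift|].
apply is_lim_seq_mult'; [easy|].
replace (Finite x) with (Finite (x / (1 + (x + 1) * 0))) by (f_equal; field).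
apply (is_lim_seq_div' (fun _ => x)); [apply is_lim_seq_const| |lra].
apply is_lim_seq_plus'; [apply is_lim_seq_const|].
apply is_lim_seq_mult'; [apply is_lim_seq_const|apply is_lim_seq_inv_S].
Qed.

(** Both sides are multiplied by (2i+1) / (2 (i+1) t^2) when [i] increases by
    1, by Gamma (x+1) = x Gamma x; at i = 0 the right side is
    sqrt PI ^ 2 / (2 t). *)
Lemma kernel_integral_limit_Gamma (t : R) (i : nat) : 0 < t ->
  kernel_integral_limit t i =
  sqrt PI * Gamma_R (INR i + 1 / 2) / (2 * INR (fact i) * t ^ (2 * i + 1)).
Proof.
intros Ht.
assert (H : exists l : R, is_lim_seq (gamma_real_seq (INR i + 1 / 2)) l /\
  kernel_integral_limit t i =
    sqrt PI * l / (2 * INR (fact i) * t ^ (2 * i + 1))).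
{ induction i as [|i [l [Hl E]]].
  - exists (sqrt PI). split.
    + simpl (INR 0). rewrite Rplus_0_l. apply is_lim_gamma_real_seq_half.
    + simpl. rewrite sqrt_sqrt by apply Rlt_le, PI_RGT_0. field. lra.
  - exists (l * (INR i + 1 / 2)). split.
    + rewrite S_INR.
      replace (INR i + 1 + 1 / 2) with (INR i + 1 / 2 + 1) by ring.
      apply is_lim_gamma_real_seq_succ; [|easy]. generalize (pos_INR i). lra.
    + cbn [kernel_integral_limit]. rewrite E, fact_simpl, mult_INR.
      replace (2 * S i + 1)%nat with (S (S (2 * i + 1))) by lia.
      rewrite plus_INR, mult_INR. simpl (INR 2). simpl (INR 1). cbn [pow].
      assert (T : t ^ (2 * i + 1) <> 0) by (apply pow_nonzero; lra).
      assert (Fi := INR_fact_neq_0 i).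
      assert (Si : INR (S i) <> 0) by (apply not_0_INR; lia).
      field. repeat split; try easy; lra. }
destruct H as [l [Hl E]]. rewrite E. do 3 f_equal.
symmetry. apply Gamma_R_lim; [|easy]. generalize (pos_INR i). lra.
Qed.

(** * The branch of the logarithm *)

(** Used for the choice of the branch of the logarithm, where any bound
    smaller than PI that holds for all t > 0 suffices. *)
Lemma theta_coarse_bound (t th : R) :
  0 < t -> is_lim_seq (theta_seq t) th ->
  Rabs (th - (t * ln t - t)) <= PI / 4.
Proof.
intros Ht Hth.
assert (B := theta_limit_bound t 0 _ (- / 2 * 0) th Ht
  (em_majorant_order_1 t Ht)
  (is_lim_seq_scal_l _ (- / 2) 0 (is_lim_seq_arg_line t Ht)) Hth).
assert (E : em_primitive t 0 0 = t * ln t - t).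
{ unfold em_primitive, arg_primitive. cbn [em_kernel].
  rewrite bernoulli_poly_deg1.
  replace (0 ^ 2 + t ^ 2) with (t * t) by ring.
  rewrite ln_mult by easy. field. }
rewrite E in B. unfold arg_line in B.
replace (0 / t) with 0 in B by (field; lra).
rewrite atan_0 in B. lra.
Qed.

Lemma cos_eq_1_small (x : R) : cos x = 1 -> Rabs x < 2 * PI -> x = 0.
Proof.
intros Hc Hx. destruct (Req_dec x 0) as [|Hn]; [easy|exfalso].
assert (P := Rabs_pos_lt x Hn).
assert (S : 0 < sin (Rabs x / 2)) by (apply sin_gt_0; lra).
assert (E : cos (Rabs x) = 1).
{ unfold Rabs. destruct (Rcase_abs x); [rewrite cos_neg|]; easy. }
replace (Rabs x) with (2 * (Rabs x / 2)) in E by field.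
rewrite cos_2a_sin in E. nra.
Qed.

(** Two polar forms of the same nonzero number: the moduli agree, so the
    angles agree modulo 2 PI. *)
Lemma lnGamma_critical_line_angle (L : C -> C) (t th : R) :
  is_lnGamma L -> 0 < t -> is_lim_seq (theta_seq t) th ->
  cos (Im (L (1 / 2, t)) - th) = 1.
Proof.
intros [_ [HL _]] Ht Hth.
destruct (Gamma_critical_line t th Ht Hth) as [r [Hr E]].
assert (S : slit_plane (1 / 2, t)) by (intros [H _]; simpl in H; lra).
rewrite <- HL in E by exact S. unfold Cexp in E.
injection E as E1 E2.
set (e := exp _) in *. assert (He : 0 < e) by apply exp_pos.
set (a := Im (L (1 / 2, t))) in *.
assert (A := sin2_cos2 a). assert (T := sin2_cos2 th). unfold Rsqr in *.
assert (Er : e = r).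
{ assert (e * e * (sin a * sin a + cos a * cos a)
     = r * r * (sin th * sin th + cos th * cos th)).
  { transitivity (e * cos a * (e * cos a) + e * sin a * (e * sin a)); [ring|].
    rewrite E1, E2. ring. }
  rewrite A, T in *. apply Rsqr_inj; unfold Rsqr; lra. }
rewrite <- Er in *.
apply Rmult_eq_reg_l in E1; [|lra]. apply Rmult_eq_reg_l in E2; [|lra].
rewrite cos_minus, E1, E2. lra.
Qed.

Lemma continuity_im_lnGamma (L : C -> C) (s : R) :
  is_lnGamma L -> continuity_pt (fun s => Im (L (1 / 2, s))) s.
Proof.
intros [HL _].
assert (S : slit_plane (1 / 2, s)) by (intros [_ H]; simpl in H; lra).
specialize (HL _ S). apply ex_derive_continuous in HL.
apply continuity_pt_filterlim.
apply (filterlim_comp _ _ _ (fun s : R => L (1 / 2, s)) Im _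
         (@locally C_UniformSpace (L (1 / 2, s)))).
- apply (filterlim_comp _ _ _ (fun s : R => (1 / 2, s) : C) L _
    (@locally (AbsRing_UniformSpace C_AbsRing) (1 / 2, s))); [|exact HL].
  intros P [eps HP]. exists eps. intros y Hy. apply HP.
  change (Cmod (Cminus (1 / 2, y) (1 / 2, s)) < eps).
  replace (Cminus (1 / 2, y) (1 / 2, s)) with ((0, y - s) : C)
    by (unfold Cminus, Cplus, Copp; simpl; f_equal; ring).
  unfold Cmod. cbn [fst snd].
  replace (0 ^ 2 + (y - s) ^ 2) with (Rsqr (y - s)) by (unfold Rsqr; ring).
  rewrite sqrt_Rsqr_abs. exact Hy.
- intros P [eps HP]. exists eps. intros y Hy. apply HP. exact (proj2 Hy).
Qed.

(** From ln y <= y at y = 1 / sqrt s. *)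
Lemma xlnx_small (s : R) : 0 < s <= 1 -> Rabs (s * ln s) <= 2 * sqrt s.
Proof.
intros [Hs H1].
assert (Q : 0 < sqrt s) by now apply sqrt_lt_R0.
assert (E : s = sqrt s * sqrt s) by (symmetry; apply sqrt_sqrt; lra).
assert (U : ln (/ sqrt s) <= / sqrt s).
{ assert (P : 0 < / sqrt s) by now apply Rinv_0_lt_compat.
  rewrite <- (ln_exp (/ sqrt s)) at 2. apply Rcomplements.ln_le; [easy|].
  generalize (exp_ineq1 (/ sqrt s)). lra. }
rewrite ln_Rinv in U by easy.
assert (L : ln s = 2 * ln (sqrt s))
  by (rewrite E at 1; rewrite ln_mult by easy; ring).
assert (N : ln s <= 0) by (rewrite <- ln_1; apply Rcomplements.ln_le; lra).
rewrite Rabs_left1 by nra.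
rewrite L. apply Rle_trans with (s * (2 * / sqrt s)).
- nra.
- right. rewrite E at 1. field. lra.
Qed.

(** Im ln Gamma (1/2 + i s) - (s ln s - s) lies within PI / 4 of a multiple of
    2 PI, so it avoids PI and - PI; being continuous and small for small [s],
    it stays between them, and then the multiple can only be 0. *)
Lemma im_lnGamma_critical_line (L : C -> C) (t th : R) :
  is_lnGamma L -> 0 < t -> is_lim_seq (theta_seq t) th ->
  Im (L (1 / 2, t)) = th.
Proof.
intros HL Ht Hth. assert (HPi := PI_RGT_0).
set (D := fun s => Im (L (1 / 2, s)) - (s * ln s - s)).
(* at +-PI the angle Im (L (1/2, s)) - ths would lie within PI / 4 of
   +-PI, where the cosine is not 1 *)
assert (Avoid : forall s, 0 < s -> Rabs (D s) <> PI).
{ intros s Hs Ds.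
  destruct (ex_lim_theta_seq s _ _ _ Hs (em_majorant_order_1 s Hs)
    (is_lim_seq_scal_l _ (- / 2) 0 (is_lim_seq_arg_line s Hs))) as [ths Hths].
  assert (B := theta_coarse_bound s ths Hs Hths).
  assert (A := lnGamma_critical_line_angle L s ths HL Hs Hths).
  unfold D in Ds. apply Rabs_le_between in B.
  apply cos_eq_1_small in A.
  - revert Ds. unfold Rabs. destruct Rcase_abs; lra.
  - revert Ds. unfold Rabs. repeat destruct Rcase_abs; lra. }
assert (Cont : forall s, 0 < s -> continuity_pt D s).
{ intros s Hs. apply continuity_pt_minus.
  - now apply continuity_im_lnGamma.
  - apply derivable_continuous_pt, ex_derive_Reals_0. auto_derive. easy. }
(* the logarithm is real at s = 0, and s ln s - s is small there *)
assert (Start : exists s0, 0 < s0 < t /\ Rabs (D s0) < PI).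
{ assert (C0 := continuity_im_lnGamma L 0 HL).
  destruct (C0 1) as [d [Hd H0]]; [lra|].
  assert (E0 : Im (L (1 / 2, 0)) = 0).
  { destruct HL as [_ [_ HR]].
    change (L (1 / 2, 0)) with (L (RtoC (1 / 2))). rewrite HR by lra. easy. }
  set (s0 := Rmin (Rmin (d / 2) (t / 2)) (1 / 4)).
  assert (Hs0 : 0 < s0) by (repeat apply Rmin_pos; lra).
  assert (Ld : s0 <= d / 2)
    by (eapply Rle_trans; [apply Rmin_l|apply Rmin_l]).
  assert (Lt : s0 <= t / 2)
    by (eapply Rle_trans; [apply Rmin_l|apply Rmin_r]).
  assert (Lq : s0 <= 1 / 4) by apply Rmin_r.
  exists s0. split; [lra|].
  assert (X := xlnx_small s0 ltac:(lra)).
  assert (Q : sqrt s0 <= 1 / 2).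
  { rewrite <- (sqrt_pow2 (1 / 2)) by lra. apply sqrt_le_1_alt. lra. }
  assert (Y : Rabs (Im (L (1 / 2, s0))) < 1).
  { rewrite <- (Rminus_0_r (Im _)). rewrite <- E0. apply H0. split.
    - split; [exact I|lra].
    - simpl. unfold Rdist. rewrite Rminus_0_r, Rabs_pos_eq; lra. }
  assert (P3 := PI2_3_2).
  unfold D. apply Rabs_lt_between in Y. apply Rabs_le_between in X.
  apply Rabs_def1; lra. }
destruct Start as [s0 [Hs0 D0]].
assert (Dt : Rabs (D t) < PI).
{ apply Rnot_le_lt. intros H.
  destruct (Ranalysis5.IVT_interv (fun s => Rabs (D s) - PI) s0 t)
    as [z [Hz Ez]].
  - intros s Hs. apply continuity_pt_minus.
    + apply (continuity_pt_comp D Rabs); [|apply Rcontinuity_abs].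
      apply Cont; lra.
    + now apply continuity_pt_const.
  - lra.
  - lra.
  - assert (A := Avoid t Ht). lra.
  - apply (Avoid z); lra. }
assert (B := theta_coarse_bound t th Ht Hth).
assert (A := lnGamma_critical_line_angle L t th HL Ht Hth).
apply Rminus_diag_uniq, cos_eq_1_small; [easy|].
unfold D in Dt. apply Rabs_le_between in B. apply Rabs_lt_between in Dt.
apply Rabs_def1; lra.
Qed.

(** * The remainder *)

Lemma im_T_hat (i : nat) (t : R) : 0 < t ->
  Im (T_hat (S i) (Ci * RtoC t)) =
  bernoulli_poly (S (2 * i + 1)) (1 / 2)
    / (INR (S (2 * i + 1)) * INR (2 * i + 1)) * im_inv_pow (2 * i + 1) t 0.
Proof.
intros Ht. unfold T_hat, im_inv_pow.
replace (2 * S i)%nat with (S (2 * i + 1)) by lia.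
replace (S (2 * i + 1) - 1)%nat with (2 * i + 1)%nat by lia.
assert (Ez : (Ci * RtoC t)%C = (0, t)).
{ unfold Ci, Cmult, RtoC. cbn [fst snd]. f_equal; ring. }
rewrite Ez.
assert (Nz : ((0, t) : C) <> RtoC 0) by (intros E; injection E; lra).
set (c := INR (S (2 * i + 1)) * INR (2 * i + 1)).
assert (Hc : c <> 0)
  by (apply Rmult_integral_contrapositive_currified; apply not_0_INR; lia).
rewrite Cpow_inv by easy.
set (b := bernoulli_poly _ _).
replace (RtoC b / (RtoC c * (0, t) ^ (2 * i + 1)))%C
  with (RtoC (b / c) * / (0, t) ^ (2 * i + 1))%C.
- unfold Im, Cmult, RtoC. cbn [fst snd]. ring.
- rewrite RtoC_div by easy. field. split.
  + now apply Cpow_nz.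
  + intros E. apply Hc. now apply RtoC_inj.
Qed.

(** The terms of [em_kernel] at v = 1/2 with a Bernoulli polynomial of odd
    index vanish, including the one with [arg_line]; the others are the
    asymptotic terms. *)
Lemma im_sum_T_hat (i : nat) (t : R) : 0 < t ->
  Im (sum_n_m (fun j => T_hat j (Ci * RtoC t)%C) 1 (S i)) =
  - em_kernel t (2 * i + 1) (1 / 2) 0.
Proof.
intros Ht. induction i as [|i IH].
- rewrite sum_n_n, im_T_hat by easy.
  change (2 * 0 + 1)%nat with 1%nat. cbn [em_kernel].
  rewrite bernoulli_poly_deg1. ring.
- rewrite sum_n_Sm by lia.
  change (Im (plus ?x ?y)) with (Im x + Im y).
  rewrite IH, im_T_hat by easy.
  replace (2 * S i + 1)%nat with (S (S (2 * i + 1))) by lia.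
  cbn [em_kernel].
  replace (S (S (2 * i + 1))) with (2 * S i + 1)%nat by lia.
  rewrite odd_bernoulli_poly_half.
  unfold Rdiv. ring.
Qed.

Lemma R_tilde_eq (L : C -> C) (i : nat) (t : R) : 0 < t ->
  R_tilde L (S i + 1) t =
  1 / 2 * (Im (L (1 / 2, t)) - em_primitive t (2 * i + 1) 0).
Proof.
intros Ht. unfold R_tilde, R_hat.
replace (S i + 1 - 1)%nat with (S i) by lia.
assert (S := im_sum_T_hat i t Ht).
set (sm := sum_n_m _ 1 (Datatypes.S i)) in *.
assert (Ez : (Ci * RtoC t)%C = (0, t)).
{ unfold Ci, Cmult, RtoC. cbn [fst snd]. f_equal; ring. }
assert (Eh : (Ci * RtoC t + RtoC (1 / 2))%C = ((1 / 2)%R, t)).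
{ rewrite Ez. unfold Cplus, RtoC. cbn [fst snd]. f_equal; ring. }
rewrite Eh, Ez. clearbody sm. destruct (L _) as [a b]. destruct sm as [c d].
unfold Im in *. cbn [snd] in *. subst d.
unfold Clog, Cmod, em_primitive, arg_primitive, RtoC.
unfold Cmult, Cminus, Cplus, Copp. cbn [fst snd].
replace (0 ^ 2 + t ^ 2) with (t * t) by ring.
replace (sqrt (t * t)) with t by (rewrite sqrt_square; lra).
rewrite (ln_mult t t) by easy. field.
Qed.

Theorem theorem6 (lnGamma : C -> C) (HlnGamma : is_lnGamma lnGamma)
    (k : nat) (hk : (1 <= k)%nat) (t : R) (ht : 0 < t) :
  Rabs (R_tilde lnGamma (k + 1) t) <=
  sqrt PI * Gamma_R (INR k - 1 / 2) * Rabs (bernoulli (2 * k))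
    / (8 * INR (fact k) * t ^ (2 * k - 1)).
Proof.
destruct k as [|i]; [lia|]. clear hk.
set (c := Rabs (bernoulli (2 * S i)) / INR (2 * S i)).
assert (Maj := em_majorant_even t i ht). fold c in Maj.
assert (Lim : is_lim_seq (fun n => c * kernel_integral t i (INR (S n)))
                (c * kernel_integral_limit t i)).
{ apply (is_lim_seq_scal_l _ c (kernel_integral_limit t i)).
  now apply is_lim_seq_kernel_integral. }
destruct (ex_lim_theta_seq t _ _ _ ht Maj Lim) as [th Hth].
assert (B := theta_limit_bound t _ _ _ th ht Maj Lim Hth). cbv beta in B.
rewrite kernel_integral_0, Rmult_0_r, Rminus_0_r in B.
rewrite R_tilde_eq, (im_lnGamma_critical_line _ _ _ HlnGamma ht Hth) by easy.
rewrite Rabs_mult, (Rabs_pos_eq (1 / 2)) by lra.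
apply Rle_trans with (1 / 2 * (c * kernel_integral_limit t i)).
{ apply Rmult_le_compat_l; [lra|exact B]. }
right. rewrite kernel_integral_limit_Gamma by easy. unfold c.
replace (INR (S i) - 1 / 2) with (INR i + 1 / 2) by (rewrite S_INR; field).
replace (2 * S i - 1)%nat with (2 * i + 1)%nat by lia.
rewrite fact_simpl, !mult_INR. simpl (INR 2).
field. repeat split.
- apply pow_nonzero; lra.
- apply INR_fact_neq_0.
- apply not_0_INR; lia.
Qed.
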